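(* Let $F=F(s,u,v,p_1,p_2,\dots)$ be the generating function of the numbers $N_{k,l}(\mu)$ of dessins d'enfants, let $f(s,t,u,v)=F|_{p_i=t,\ i=1,2,\dots}$, and write $$f(s,t,u,v)=\sum_{g=0}^\infty\sum_{d=2g+1}^\infty \frac{f_{g,d}(t,u,v)}{d}\,s^d ,$$ where $f_{g,d}(t,u,v)$ is the homogeneous component of degree $d+2-2g$ in $t,u,v$ (the contribution of dessins of genus $g$ with $d$ edges); put $f_{g,d}=0$ if $g<0$ or $d<2g+1$. Then $f_{0,1}=tuv$ and for all $g\ge0$, $d\ge2$ \begin{align*} (d+1)f_{g,d}&=(2d-1)\,a\,f_{g,d-1}+(d-2)\,b\,f_{g,d-2}+(d-1)^2(d-2)f_{g-1,d-2}\\ &\quad+\sum_{i=0}^g\sum_{j=1}^{d-3}(4+6j)(d-2-j)f_{i,j}f_{g-i,d-2-j}, \end{align*} where $a=t+u+v$ and $b=4(tu+tv+uv)-a^2$.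
   Context: A Belyi pair $(C,\phi)$ is a smooth compact connected complex algebraic curve $C$ together with a non-constant meromorphic function $\phi:C\to\mathbb{C}P^1$ unramified over $\mathbb{C}P^1\setminus\{0,1,\infty\}$. For positive integers $k,l,m$ and $\mu=(\mu_1,\dots,\mu_m)\in\mathbb{Z}_{>0}^m$, let $\mathcal{D}_{k,l;\mu}$ be the set of isomorphism classes of Belyi pairs with $|\phi^{-1}(0)|=k$, $|\phi^{-1}(1)|=l$ (numbers of distinct points), whose $m$ poles are labeled $1,\dots,m$, the $i$-th pole having order $\mu_i$ (isomorphisms commute with the maps $\phi$ and preserve the labels). Equivalently, these are connected bicolored ribbon graphs (dessins) $\Gamma=\phi^{-1}([0,1])$ with $k$ white vertices, $l$ black vertices, $d=\sum_i\mu_i$ edges and $m$ labeled boundary components; the genus $g$ of $C$ satisfies $k+l-d+m=2-2g$. Put $N_{k,l}(\mu)=\sum_{\Gamma\in\mathcal{D}_{k,l;\mu}}1/|\mathrm{Aut}_b\Gamma|$, where $\mathrm{Aut}_b\Gamma$ is the finite group of automorphisms preserving each boundary component (i.e. each pole). The generating function is $$F(s,u,v,p_1,p_2,\dots)=\sum_{k,l,m\ge1}\frac1{m!}\sum_{\mu\in\mathbb{Z}_{>0}^m}N_{k,l}(\mu)\,s^{d}u^kv^l\,p_{\mu_1}\cdots p_{\mu_m},\qquad d=\sum_{i=1}^m\mu_i .$$ *)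

(* Defs.v *)
From HB Require Import structures.
From mathcomp Require Import all_boot all_order all_algebra all_fingroup.
From mathcomp Require Import mpoly.

Set Implicit Arguments.
Unset Strict Implicit.
Unset Printing Implicit Defensive.

Import GRing.Theory.
Local Open Scope ring_scope.

(* A bicolored ribbon graph with edge set E is given by the two permutations
   of E that rotate the edges around the white and around the black vertices:
   white vertices, black vertices and boundary components are the cycles of
   white, of black and of their product.  The boundary component of a cycle of
   length r runs along 2r edge sides, r of them from white to black, so it is a
   pole of order r.
   The i-th boundary component is recorded as the set face i of edges in its
   cycle. *)
Record dessin (E : finType) (m : nat) := Dessin {
  white : {perm E};
  black : {perm E};
  face : {ffun 'I_m -> {set E}}
}.

Section DessinFinite.
Variables (E : finType) (m : nat).

Definition dessin_tuple (D : dessin E m) := (white D, black D, face D).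
Definition tuple_dessin (x : {perm E} * {perm E} * {ffun 'I_m -> {set E}}) :=
  Dessin x.1.1 x.1.2 x.2.

Lemma dessin_tupleK : cancel dessin_tuple tuple_dessin.
Proof. by case. Qed.

HB.instance Definition _ := Finite.copy (dessin E m) (can_type dessin_tupleK).
End DessinFinite.

Section Dessins.
Variables (E : finType) (m : nat).
Implicit Types D : dessin E m.

(* Connectedness is transitivity on the edges of the group generated by the two
   rotations; in particular it forces E to be nonempty. *)
Definition is_dessin (k l : nat) (mu : 'I_m -> nat) : pred (dessin E m) :=
  fun D =>
  [&& #|porbits (white D)| == k,
      #|porbits (black D)| == l,
      [transitive <<[set white D; black D]>>, on [set: E] | 'P],
      injectiveb (face D),
      [set face D i | i : 'I_m] == porbits (white D * black D)%g
    & [forall i, #|face D i| == mu i]].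

Definition relabel (h : {perm E}) D : dessin E m :=
  Dessin (white D ^ h)%g (black D ^ h)%g [ffun i => h @: face D i].

Definition dessin_iso : rel (dessin E m) :=
  fun D D' => [exists h : {perm E}, relabel h D == D'].

Definition dessin_aut D : {set {perm E}} := [set h | relabel h D == D].

End Dessins.

(* N_{k,l}(mu).  Every dessin with d edges is isomorphic to one with edge set
   'I_d, and the transversal contains one dessin of each isomorphism class. *)
Definition num_dessins (k l m : nat) (mu : 'I_m -> nat) : rat :=
  let Ds := [set D : dessin 'I_(\sum_i mu i) m | is_dessin k l mu D] in
  \sum_(D in transversal (equivalence_partition (@dessin_iso _ m) Ds) Ds)
    (#|dessin_aut D|%:R)^-1.

Lemma num_dessins_gt k l m (mu : 'I_m -> nat) :
  (\sum_i mu i < k)%N || (\sum_i mu i < l)%N -> num_dessins k l mu = 0.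
Proof.
move=> h; rewrite /num_dessins /=.
have le_porbits (s : {perm 'I_(\sum_i mu i)}) :
    (#|porbits s| <= \sum_i mu i)%N.
  by rewrite (leq_trans (leq_imset_card _ _)) // card_ord.
apply: big1 => D /imsetP[D' + _]; rewrite inE => /and3P[/eqP hk /eqP hl _].
by move: h; rewrite -hk -hl !ltnNge !le_porbits.
Qed.

(* The coefficient of s^d in F.  It is a polynomial in u, v and the p_i, and is
   presented as the map evaluating this polynomial at arbitrary elements of a
   commutative Q-algebra, so that specializing F is applying genF.  The summation
   ranges lose nothing: k, l > d contribute 0 (num_dessins_gt), and a sequence
   mu of m positive integers with sum d has m <= d and mu_i <= d. *)
Definition genF (A : comAlgType rat) (u v : A) (p : nat -> A) (d : nat) : A :=
  \sum_(1 <= k < d.+1) \sum_(1 <= l < d.+1) \sum_(1 <= m < d.+1)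
    (m`!%:R)^-1 *:
    \sum_(mu : {ffun 'I_m -> 'I_d.+1} |
          [forall i, 0 < mu i]%N && (\sum_i mu i == d)%N)
      num_dessins k l (fun i => mu i : nat) *:
        (u ^+ k * v ^+ l * \prod_i p (mu i)).

Definition t : {mpoly rat[3]} := 'X_(inord 0).
Definition u : {mpoly rat[3]} := 'X_(inord 1).
Definition v : {mpoly rat[3]} := 'X_(inord 2).

(* The coefficient of s^d in f(s,t,u,v). *)
Definition f_coef (d : nat) : {mpoly rat[3]} := genF u v (fun=> t) d.

Definition f_ (g : int) (d : nat) : {mpoly rat[3]} :=
  if g is Posz g' then
    if (2 * g' + 1 <= d)%N
    then d%:R *: pihomog mdeg (d + 2 - 2 * g') (f_coef d)
    else 0
  else 0.

(* Main.v *)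
Require Import Defs.
From HB Require Import structures.
From mathcomp Require Import all_boot all_order all_algebra all_fingroup generic_quotient.
From mathcomp Require Import ssrcomplements mpoly ring zify.

(** Summed over all genera, the recursion is a differential equation for the
    logarithmic derivative s d/ds log Z, where Z is the sum over d of s^d / d! times
    the sum of v^c(p) u^c(q) t^c(qp) over all pairs of permutations p, q of d
    points, and c counts cycles; f = log Z because the joint orbit of a point can be
    split off a pair. The coefficients being polynomials, it suffices to prove the
    equation at t = N + al, u = N, v = -M with N, al, M natural numbers. There,
    removing a point from a permutation matches integration by parts in the Laguerre
    ensemble of N variables, so Z is, up to a constant, the mean of the product of
    the (1 - s x_a)^M, that is a Hankel determinant of size N. Such determinants
    satisfy the Toda equation for s^2 d/ds, and together with the Laguerre-Freud
    relation this carries the differential equation from N to N + 1. Finally each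
    f_{g,d} is a homogeneous component, so that the recursion splits by degree. *)

Set Implicit Arguments.
Unset Strict Implicit.
Unset Printing Implicit Defensive.

Import GRing.Theory Num.Theory.
Local Open Scope ring_scope.

(** * The differential equation along a Toda chain *)

(** A negative integer v makes everything finite. The sum over p of v^c(p) times the power sum of
    the cycle type of p generates the product of the (1 - s x_a)^(-v); for v = -M this is a
    polynomial, and so is Z in the variable s. The integral can therefore be a formal functional on
    polynomials. The mean of the power sum attached to p is the sum over q of u^c(q) t^c(qp), as for
    the eigenvalues of a complex Wishart matrix. The obstacle is that the Toda equation links three
    consecutive sizes, whereas the differential equation concerns a single one. The derivative of
    [alp n] involves [bet n.+1]; the Laguerre-Freud relation eliminates it and leaves one quadratic
    equation for [alp n] over [logd n] and [bet n], which is what the induction on N transports. The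
    Toda chain divides by determinants, hence runs in the fraction field of Q[s]. Clearing
    denominators gives an equation quadratic in Z, which descends to polynomials and can be compared
    with truncated series. *)

Definition derivation (R : comNzRingType) (D : R -> R) :=
  (forall x y, D (x + y) = D x + D y) /\ (forall x y, D (x * y) = D x * y + x * D y).

Section DerivationTheory.
Variables (R : comNzRingType) (D : R -> R).
Hypothesis hD : derivation D.

Lemma derD x y : D (x + y) = D x + D y. Proof. by case: hD. Qed.
Lemma derM x y : D (x * y) = D x * y + x * D y. Proof. by case: hD. Qed.

Lemma der_0 : D 0 = 0.
Proof. by apply: (addrI (D 0)); rewrite -derD !addr0. Qed.

Lemma derN x : D (- x) = - D x.
Proof. by apply: (addrI (D x)); rewrite -derD !subrr der_0. Qed.

Lemma der_sum I (r : seq I) P (F : I -> R) :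
  D (\sum_(i <- r | P i) F i) = \sum_(i <- r | P i) D (F i).
Proof. exact: (big_morph D derD der_0). Qed.

Lemma der_1 : D 1 = 0.
Proof. by apply: (addrI (D 1)); rewrite addr0 -{3}[1]mulr1 derM mulr1 mul1r. Qed.

Lemma der_nat n : D n%:R = 0.
Proof. by elim: n => [|n IH]; rewrite ?der_0 // -natr1 derD IH der_1 addr0. Qed.

Lemma der_natMl n x : D (n%:R * x) = n%:R * D x.
Proof. by rewrite derM der_nat mul0r add0r. Qed.

Lemma derX x n : D (x ^+ n) = n%:R * x ^+ n.-1 * D x.
Proof.
elim: n => [|n IH]; first by rewrite expr0 der_1 !mul0r.
rewrite exprS derM IH /= -natr1; case: n {IH} => [|n]; rewrite ?expr0 /= ?exprS; ring.
Qed.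

Lemma derivation_scale c : derivation (fun x => c * D x).
Proof. by split=> x y; rewrite ?derD ?derM; ring. Qed.
End DerivationTheory.

Lemma derV (F : fieldType) (D : F -> F) (hD : derivation D) x : x != 0 -> D x^-1 = - D x / x ^+ 2.
Proof.
move=> x0; have := der_1 hD; rewrite -(divff x0) derM // => h.
apply: (mulfI x0); have -> : x * D x^-1 = - (D x / x) by apply/eqP; rewrite -addr_eq0 addrC h.
by field.
Qed.

Section TodaChain.
Variables (F : fieldType) (th : F -> F) (s : F) (al M : nat) (H : nat -> F).
Hypotheses (hth : derivation th) (s0 : s != 0) (ths : th s = s).
Let d x := s * th x.
Hypotheses (H0 : H 0 = 1) (Hn0 : forall n, H n != 0).
Hypothesis toda : forall n, H n.+2 * H n = H n.+1 * d (d (H n.+1)) - d (H n.+1) ^+ 2.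
Hypothesis pearson : d (d (H 1)) = ((al + M + 2)%:R * s + 1) * d (H 1) - (al.+1)%:R * s * H 1.

Let dD : derivation d := derivation_scale hth s.
Let ds : d s = s ^+ 2. Proof. by rewrite /d ths expr2. Qed.

(* [bet] and [alp] are the squares of the off-diagonal and the diagonal recurrence
   coefficients of the orthogonal polynomials whose Hankel determinants are the [H n]. *)
Definition logd n := d (H n) / H n.
Let p := logd.

Definition bet n := d (p n).
Let b := bet.

Definition alp n := p n.+1 - p n.
Let a := alp.
Let B n : F := (al + M + 2 * n)%:R.
Let k n : F := (n * (n + al))%:R.

Definition todaQ n := b n + B n * s * b n + B n * s ^+ 2 * p n - k n * s ^+ 2.
Let Q := todaQ.

Definition todaK n := b n ^+ 2 + s * b n * ((2 * n + al + 1)%:R - 2%:R * p n) + (B n + 1) * s ^+ 2 * b n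
  + M%:R * s ^+ 2 * p n + s ^+ 2 * p n ^+ 2 + B n * (B n + 1) * s ^+ 3 * p n - (B n + 1) * k n * s ^+ 3.
Let K := todaK.

Let p0 : p 0 = 0. Proof. by rewrite /p /logd H0 (der_1 dD) mul0r. Qed.
Let b0 : b 0 = 0. Proof. by rewrite /b /bet p0 (der_0 dD). Qed.

Lemma betS n : b n.+1 = H n.+2 * H n / H n.+1 ^+ 2.
Proof.
have h := Hn0 n.+1; rewrite toda /b /bet /p /logd (derM dD) (derV dD h); field; exact: h.
Qed.

Lemma betS_neq0 n : b n.+1 != 0.
Proof. by rewrite betS !mulf_neq0 ?invr_eq0 ?expf_neq0. Qed.

Lemma d_alp n : d (a n) = b n.+1 - b n.
Proof. by rewrite (derD dD) (derN dD). Qed.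

Lemma d_betS n : d (b n.+1) = b n.+1 * (a n.+1 - a n).
Proof.
have h := Hn0 n.+1; have h2 := Hn0 n.+2; have h0 := Hn0 n.
rewrite betS (derM dD) (derM dD) (derV dD) ?expf_neq0 // expr2 (derM dD).
rewrite /a /alp /p /logd; field; by rewrite h h2 h0.
Qed.

(* [todaG n (a n) = 0] is the differential equation to be proved, [b n.+1] being
   eliminated through [laguerre_freud n].  The induction rests on
   [todaG n.+1 (a n + 2 * s) = todaG n (a n)], an identity of polynomials once b n.+1 and
   p n.+1 are expressed at n, and on the other root of [todaG n.+1] being [a n.+1]. *)
Definition laguerre_freud n := b n.+1 = - a n ^+ 2 - b n + (B n + 2%:R) * s * a n + a n
  + 2%:R * s * p n - s * (2 * n + al + 1)%:R.

Definition todaG n x := b n * x ^+ 2 - x * (Q n + 2%:R * s * b n) + K n.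

Lemma laguerre_freud0 : laguerre_freud 0.
Proof.
rewrite /laguerre_freud b0 p0 /b /bet /a /alp p0 /p /logd (derM dD) (derV dD) // pearson.
rewrite /B; have h := Hn0 1; field; exact: h.
Qed.

Let d_rhs (m c e : nat) (x y z : F) :
  d (- x ^+ 2 - y + (m%:R + e%:R) * s * x + x + e%:R * s * z - s * c%:R) =
  - (x * d x + d x * x) - d y + (m%:R + e%:R) * (s ^+ 2 * x + s * d x) + d x
    + e%:R * (s ^+ 2 * z + s * d z) - s ^+ 2 * c%:R.
Proof.
by rewrite !(derD dD, derN dD, derM dD, expr2, der_nat dD) ds; ring.
Qed.

Let d_Q (m c : nat) (y z : F) :
  d (y + m%:R * s * y + m%:R * s ^+ 2 * z - c%:R * s ^+ 2) =
  d y + m%:R * (s ^+ 2 * y + s * d y) + m%:R * (2%:R * s ^+ 3 * z + s ^+ 2 * d z)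
    - 2%:R * c%:R * s ^+ 3.
Proof.
by rewrite !(derD dD, derN dD, derM dD, expr2, der_nat dD) ds; ring.
Qed.

(** Everything vanishes at n = 0 except the first statement, which is the Pearson relation. In the
    step, differentiating the first statement gives the second at n.+1; comparing that with [d_betS]
    gives [SQ], whose derivative is [b n.+1] times the first statement at n.+1. *)
Lemma chain n : [/\ laguerre_freud n, d (b n) + Q n = 2%:R * b n * a n & todaG n (a n) = 0].
Proof.
elim: n => [|n [IL IR IG]].
  split; first exact: laguerre_freud0; rewrite /todaG /Q /K /todaQ /todaK /k !b0 !p0 ?(der_0 dD); ring.
have p1 : p n.+1 = p n + a n by rewrite /a /alp; ring.
have R1 : d (b n.+1) + Q n.+1 = 2%:R * b n.+1 * a n.+1.
  suff h : Q n.+1 = d (b n.+1) + 2%:R * a n * b n.+1 by rewrite h d_betS; ring.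
  have {}IR : d (b n) = 2%:R * b n * a n - Q n by rewrite -IR; ring.
  have -> : d (b n.+1) = - 2%:R * a n * (b n.+1 - b n) - d (b n) + (B n + 2%:R) * (s ^+ 2 * a n + s * (b n.+1 - b n))
     + (b n.+1 - b n) + 2%:R * (s ^+ 2 * p n + s * b n) - s ^+ 2 * (2 * n + al + 1)%:R.
    rewrite {1}IL d_rhs d_alp -[d (p n)]/(b n); ring.
  rewrite IR /Q /todaQ p1 IL /B /k; ring.
have G1 : todaG n.+1 (a n + 2%:R * s) = 0.
  rewrite -IG /todaG /Q /K /todaQ /todaK p1 IL /B /k; ring.
have dE := d_betS n.
(* Equivalently, by Vieta, the roots of [todaG n.+1] add up to [a n + 2 s + a n.+1]. *)
have SQ : b n.+1 * (a n.+1 + a n) = Q n.+1.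
  by apply: (addrI (d (b n.+1))); rewrite R1 dE; ring.
split=> //; last first.
  have -> : todaG n.+1 (a n.+1) = todaG n.+1 (a n + 2%:R * s) + (a n.+1 - a n - 2%:R * s) * (b n.+1 * (a n.+1 + a n) - Q n.+1).
    by rewrite /todaG; ring.
  by rewrite G1 SQ subrr mulr0 addr0.
apply: (mulfI (betS_neq0 n)).
have := congr1 d SQ; rewrite (derM dD) (derD dD) !d_alp dE.
rewrite /Q /todaQ d_Q -[d (p n.+1)]/(b n.+1) dE => h.
have h' : b n.+1 * b n.+2 = b n.+1 * b n - b n.+1 * (a n.+1 ^+ 2 - a n ^+ 2)
   + b n.+1 * (a n.+1 - a n) + B n.+1 * (s ^+ 2 * b n.+1 + s * (b n.+1 * (a n.+1 - a n)))
   + B n.+1 * (2%:R * s ^+ 3 * p n.+1 + s ^+ 2 * b n.+1) - k n.+1 * 2%:R * s ^+ 3.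
  apply: (addrI (b n.+1 * (a n.+1 - a n) * (a n.+1 + a n) - b n.+1 * b n)).
  transitivity (b n.+1 * (a n.+1 - a n) * (a n.+1 + a n) + b n.+1 * (b n.+2 - b n.+1 + (b n.+1 - b n))); first by ring.
  rewrite h; ring.
rewrite h'.
have bE : b n = - b n.+1 - a n ^+ 2 + (B n + 2%:R) * s * a n + a n + 2%:R * s * p n - s * (2 * n + al + 1)%:R.
  by rewrite {1}IL; ring.
have pE : p n = p n.+1 - a n by rewrite p1; ring.
(* In [h'] only the terms in [p n.+1] and [k n.+1] lack the factor [b n.+1]; [SQ] trades them for
   multiples of it. *)
have E2 : B n.+1 * s ^+ 2 * p n.+1 - k n.+1 * s ^+ 2 = b n.+1 * (a n.+1 + a n) - b n.+1 - B n.+1 * s * b n.+1.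
  by rewrite SQ /Q /todaQ; ring.
have E3 : B n.+1 * (2%:R * s ^+ 3 * p n.+1) =
    2%:R * s * (b n.+1 * (a n.+1 + a n) - b n.+1 - B n.+1 * s * b n.+1)
    + 2%:R * k n.+1 * s ^+ 3 by rewrite -E2; ring.
rewrite (mulrDr (B n.+1) (2%:R * _ * _)) E3 bE pE /B; ring.
Qed.

(** The subtracted constant is the logarithmic derivative of a factor s^(n (n + al)) of [H n]. The
    third derivative of X brings in [b n.+1]; once it is eliminated, the two sides differ by 2
    [todaG n (a n)] / s^2. *)
Theorem toda_ode n (X := th (H n) / H n - (n * (n + al))%:R)
    (t := - M%:R : F) (u := n%:R) (v := (n + al)%:R) (c := t + u + v) :
  th X + X = 2%:R * s * t * u * v + c * s * (2%:R * th X + X)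
    + s ^+ 2 * ((4%:R * (t * u + t * v + u * v) - c ^+ 2) * th X
      + th (th (th X)) + 2%:R * th (th X) + th X + 4%:R * X * th X + 6%:R * th X ^+ 2).
Proof.
have [IL IR IG] := chain n.
have thE x : th x = d x / s by rewrite /d mulrC mulKf.
have dVs i : d (s ^- i.+1) = - (i.+1)%:R * s ^- i.
  rewrite (derV dD) ?expf_neq0 // (derX dD) ds /= (exprS s i); have := expf_neq0 i s0; move: (s ^+ i) => y y0; field; by rewrite ?y0 ?s0.
have dsV x i : d (x / s ^+ i.+1) = d x / s ^+ i.+1 - (i.+1)%:R * x / s ^+ i.
  by rewrite (derM dD) dVs; ring.
have {IR} db : d (b n) = 2%:R * b n * a n - Q n by rewrite -IR; ring.
have dp : d (p n) = b n by [].
pose b2 := 2%:R * d (b n) * a n + 2%:R * b n * (b n.+1 - b n) -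
  (d (b n) + B n * (s ^+ 2 * b n + s * d (b n))
   + B n * (2%:R * s ^+ 3 * p n + s ^+ 2 * b n) - 2%:R * k n * s ^+ 3).
have ddb : d (d (b n)) = b2.
  rewrite {1}db (derD dD) (derN dD) (derM dD) (derM dD) d_alp.
  by rewrite (der_nat dD 2) /Q /todaQ d_Q -[d (p n)]/(b n) -/(b n) /b2; ring.
have XE : X = p n / s ^+ 1 - k n.
  by rewrite /X /p /logd /d; field; rewrite s0 Hn0.
have X1 : th X = b n / s ^+ 2 - p n / s.
  by rewrite thE XE (derD dD) (derN dD) (der_nat dD) dsV dp; field; by rewrite ?expf_neq0 ?oner_neq0 ?s0.
have X2 : th (th X) = d (b n) / s ^+ 3 - 3%:R * (b n / s ^+ 2) + p n / s ^+ 1.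
  rewrite thE X1 -{2}[s]expr1 (derD dD) (derN dD) !dsV dp; field; by rewrite ?expf_neq0 ?oner_neq0 ?s0.
have X3 : th (th (th X)) = b2 / s ^+ 4 - 6%:R * d (b n) / s ^+ 3 + 7%:R * b n / s ^+ 2 - p n / s.
  rewrite thE X2 !(derD dD) (derN dD) (der_natMl dD) !dsV ddb dp; field; by rewrite ?expf_neq0 ?oner_neq0 ?s0.
apply/eqP; rewrite eq_sym -subr_eq0; apply/eqP.
transitivity (2%:R * todaG n (a n) / s ^+ 2); last by rewrite IG mulr0 mul0r.
rewrite X3 X2 X1 XE /b2 db IL /todaG /Q /K /todaQ /todaK /c /t /u /v /B /k.
field; by rewrite ?expf_neq0 ?oner_neq0 ?s0.
Qed.
End TodaChain.

(* The differential equation for the logarithmic derivative of z, cleared of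
   denominators: it then makes sense, and can be truncated, for polynomials z. *)
Definition bilin (R : comNzRingType) (th : R -> R) (s t u v z : R) :=
  let z1 := th z in let z2 := th z1 in let z3 := th z2 in let z4 := th z3 in
  let c := t + u + v in
  2%:R * s * t * u * v * z ^+ 2 + c * s * (2%:R * (z2 * z - z1 ^+ 2) + z1 * z)
  + s ^+ 2 * ((4%:R * (t * u + t * v + u * v) - c ^+ 2) * (z2 * z - z1 ^+ 2)
     + z4 * z - 4%:R * z1 * z3 + 3%:R * z2 ^+ 2 + 2%:R * z3 * z - 2%:R * z1 * z2
     + z2 * z - z1 ^+ 2) - (z2 * z - z1 ^+ 2 + z1 * z).

(** The coefficients 4 and 6 are exactly those for which the cubic and quartic poles cancel: 6 (th
    X)^2 against the third derivative of X, and 4 X th X against twice the second. Only z^2 remains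
    in the denominator. *)
Lemma log_ode_bilin (F : fieldType) (th : F -> F) (hth : derivation th) (s t u v z : F)
    (X := th z / z) (c := t + u + v) : z != 0 ->
  th X + X = 2%:R * s * t * u * v + c * s * (2%:R * th X + X)
    + s ^+ 2 * ((4%:R * (t * u + t * v + u * v) - c ^+ 2) * th X
      + th (th (th X)) + 2%:R * th (th X) + th X + 4%:R * X * th X + 6%:R * th X ^+ 2) ->
  bilin th s t u v z = 0.
Proof.
move=> z0.
have dV i : th (z ^- i.+1) = - (i.+1)%:R * th z / z ^+ i.+2.
  rewrite (derV hth) ?expf_neq0 // (derX hth) /= !(exprS z) /=.
  by have := expf_neq0 i z0; move: (z ^+ i) => y y0; field; rewrite ?y0 ?z0.
have dq x i : th (x / z ^+ i.+1) = th x / z ^+ i.+1 - (i.+1)%:R * x * th z / z ^+ i.+2.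
  by rewrite (derM hth) dV; ring.
have X0 : X = th z / z ^+ 1 by [].
have X1 : th X = th (th z) / z ^+ 1 - th z ^+ 2 / z ^+ 2.
  by rewrite X0 dq; ring.
have X2 : th (th X) = th (th (th z)) / z ^+ 1 - 3%:R * (th z * th (th z) / z ^+ 2)
    + 2%:R * (th z ^+ 3 / z ^+ 3).
  by rewrite X1 (derD hth) (derN hth) !dq (derX hth); field; rewrite ?oner_neq0 z0.
have X3 : th (th (th X)) = th (th (th (th z))) / z - 4%:R * th z * th (th (th z)) / z ^+ 2
    - 3%:R * th (th z) ^+ 2 / z ^+ 2 + 12%:R * th z ^+ 2 * th (th z) / z ^+ 3
    - 6%:R * th z ^+ 4 / z ^+ 4.
  rewrite X2 !(derD hth) (derN hth) !(der_natMl hth) !dq (derX hth) (derM hth).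
  by field; rewrite ?oner_neq0 z0.
move=> h; have {h} := congr1 (fun x => x * z ^+ 2) h.
rewrite X3 X2 X1 X0 => /eqP; rewrite eq_sym -subr_eq0 => /eqP <-.
by rewrite /bilin /c; field; rewrite ?oner_neq0 z0.
Qed.

Theorem toda_bilin (F : fieldType) (th : F -> F) (s : F) (al M : nat) (z : nat -> F)
    (hth : derivation th) (d := fun x => s * th x) (H := fun n => s ^+ (n * (n + al)) * z n) :
  s != 0 -> th s = s -> H 0 = 1 -> (forall n, z n != 0) ->
  (forall n, H n.+2 * H n = H n.+1 * d (d (H n.+1)) - d (H n.+1) ^+ 2) ->
  d (d (H 1)) = ((al + M + 2)%:R * s + 1) * d (H 1) - (al.+1)%:R * s * H 1 ->
  forall n, bilin th s (- M%:R) n%:R (n + al)%:R (z n) = 0.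
Proof.
move=> s0 ths H0 zn hT hP n.
have Hn m : H m != 0 by rewrite mulf_neq0 ?expf_neq0.
have := toda_ode hth s0 ths H0 Hn hT hP n.
have -> : th (H n) / H n - (n * (n + al))%:R = th (z n) / z n.
  rewrite /H (derM hth) (derX hth) ths; move: (n * (n + al))%N => [|k] /=.
    by rewrite !expr0; field; rewrite zn.
  rewrite exprS; have := expf_neq0 k s0; move: (s ^+ k) => y y0.
  by field; rewrite zn y0 s0.
by apply: log_ode_bilin.
Qed.

Lemma bilin_rmorph (R S : comNzRingType) (f : {rmorphism R -> S}) th th' s t u v z :
  (forall x, th' (f x) = f (th x)) ->
  f (bilin th s t u v z) = bilin th' (f s) (f t) (f u) (f v) (f z).
Proof.
by move=> h; rewrite /bilin !h !(rmorphD, rmorphB, rmorphN, rmorphM, rmorphXn, rmorph_nat, rmorph1).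
Qed.

(** * Extension of a derivation to the field of fractions *)

Section QuotientRule.
Variables (F : fieldType) (n d n' d' m e m' e' : F).
Hypotheses (d0 : d != 0) (e0 : e != 0).

(** The second hypothesis is the derivative of the first, so the quotient rule is independent of the
    chosen fraction. *)
Lemma quotient_rule_wd : n * e = m * d -> n' * e + n * e' = m' * d + m * d' ->
  (m' * e - m * e') / e ^+ 2 = (n' * d - n * d') / d ^+ 2.
Proof.
move=> h h'.
have -> : m' = (n' * e + n * e' - m * d') / d by rewrite h'; field.
have -> : m = n * e / d by rewrite h; field.
by field; rewrite ?d0 ?e0.
Qed.

Lemma quotient_ruleD :
  ((n' * e + n * e' + (m' * d + m * d')) * (d * e) - (n * e + m * d) * (d' * e + d * e'))
    / (d * e) ^+ 2 = (n' * d - n * d') / d ^+ 2 + (m' * e - m * e') / e ^+ 2.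
Proof. by field; rewrite ?d0 ?e0. Qed.

Lemma quotient_ruleM :
  ((n' * m + n * m') * (d * e) - (n * m) * (d' * e + d * e')) / (d * e) ^+ 2 =
  (n' * d - n * d') / d ^+ 2 * (m / e) + n / d * ((m' * e - m * e') / e ^+ 2).
Proof. by field; rewrite ?d0 ?e0. Qed.
End QuotientRule.

Section FractionDerivation.
Local Open Scope quotient_scope.
Variables (R : idomainType) (D : R -> R).
Hypothesis hD : derivation D.
Local Notation "x %:F" := (@FracField.tofrac R x).

Lemma frac_repr (x : {fraction R}) : x = (\n_(repr x))%:F / (\d_(repr x))%:F.
Proof.
rewrite -{1}[x]reprK; case: (repr x) => -[n d] /= d0.
rewrite !piE; apply/eqmodP.
rewrite /= FracField.equivfE /FracField.mulf /FracField.invf /=.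
by rewrite !numden_Ratio ?mulf_neq0 ?oner_neq0 ?mulr1 ?mul1r 1?mulrC.
Qed.

Lemma frac_denom_neq0 (x : {fraction R}) : (\d_(repr x))%:F != 0.
Proof. by rewrite tofrac_eq0 denom_ratioP. Qed.

Definition frac_deriv (x : {fraction R}) : {fraction R} :=
  let n := \n_(repr x) in let d := \d_(repr x) in
  ((D n)%:F * d%:F - n%:F * (D d)%:F) / d%:F ^+ 2.

Lemma frac_derivE n d : d != 0 ->
  frac_deriv (n%:F / d%:F) = ((D n)%:F * d%:F - n%:F * (D d)%:F) / d%:F ^+ 2.
Proof.
move=> d0; rewrite /frac_deriv; have := frac_repr (n%:F / d%:F).
have := frac_denom_neq0 (n%:F / d%:F).
move: (\n_ _) (\d_ _) => m e e0; have {}d0 : d%:F != 0 by rewrite tofrac_eq0.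
move/eqP; rewrite eqr_div // -!tofracM tofrac_eq => /eqP h.
have hF : n%:F * e%:F = m%:F * d%:F by rewrite -!tofracM h.
have := congr1 (fun x => (D x)%:F) h; rewrite !(derM hD) !tofracD !tofracM.
exact: quotient_rule_wd.
Qed.

Lemma frac_deriv_tofrac n : frac_deriv n%:F = (D n)%:F.
Proof.
have := frac_derivE n (oner_neq0 _); rewrite tofrac1 divr1 => ->.
by rewrite (der_1 hD) tofrac0 mulr0 subr0 mulr1 expr1n divr1.
Qed.

Lemma frac_derivation : derivation frac_deriv.
Proof.
split=> x y; rewrite (frac_repr x) (frac_repr y).
all: have := frac_denom_neq0 x; have := frac_denom_neq0 y.
all: move: (\n_ _) (\d_ _) (\n_ _) (\d_ _) => n d m e d0 e0.
  rewrite addf_div // -!tofracM -tofracD.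
  rewrite !frac_derivE ?mulf_neq0 -1?tofrac_eq0 // (derD hD) !(derM hD) !(tofracD, tofracM).
  exact: quotient_ruleD.
rewrite mulf_div -!tofracM.
rewrite !frac_derivE ?mulf_neq0 -1?tofrac_eq0 // !(derM hD) !(tofracD, tofracM).
exact: quotient_ruleM.
Qed.
End FractionDerivation.

(** * Hankel determinants of Laguerre moments *)

(** Entries are indexed by natural numbers, so that determinants of different sizes share one entry
    function. *)
Definition detn (F : comNzRingType) m (f : nat -> nat -> F) := \det (\matrix_(i < m, j < m) f i j).

Lemma detn_tr (R : comNzRingType) m (f : nat -> nat -> R) : detn m f = detn m (fun i j => f j i).
Proof. by rewrite /detn -det_tr; congr (\det _); apply/matrixP=> i j; rewrite !mxE. Qed.

Lemma eq_detn (R : comNzRingType) m (f f' : nat -> nat -> R) : (forall i j, (i < m)%N -> (j < m)%N -> f i j = f' i j) -> detn m f = detn m f'.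
Proof. by move=> h; congr (\det _); apply/matrixP=> i j; rewrite !mxE h. Qed.

(** * Schur complements and the Toda equation *)

Section Schur.
Variable F : fieldType.
Implicit Type f : nat -> nat -> F.

Definition schur n f i j : F := f i j -
  \sum_(k < n) \sum_(l < n) f i k * invmx (\matrix_(i < n, j < n) f i j) k l * f l j.

(** Block LU factorization along the leading block of size n. The cases m = 1 and m = 2 express
    bordered Hankel determinants through one function on pairs of indices. *)
Lemma detn_schur n m f : detn n f != 0 ->
  detn (n + m) f = detn n f * detn m (fun i j => schur n f (n + i) (n + j)).
Proof.
move=> f0; pose A := \matrix_(i < n, j < n) f i j.
pose C := \matrix_(i < n, j < m) f i (n + j)%N.
pose R := \matrix_(i < m, j < n) f (n + i)%N j.
pose S := \matrix_(i < m, j < m) schur n f (n + i) (n + j).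
have uA : A \in unitmx by rewrite unitmxE unitfE.
have SE : R *m invmx A *m C + S = \matrix_(i < m, j < m) f (n + i)%N (n + j)%N.
  apply/matrixP=> i j; rewrite !mxE /schur addrC -[RHS]addr0 -addrA; congr (_ + _).
  apply/eqP; rewrite addrC subr_eq0; apply/eqP; rewrite exchange_big; apply: eq_bigr => l _.
  by rewrite !mxE mulr_suml; apply: eq_bigr => k _; rewrite !mxE.
have -> : detn (n + m) f = \det (block_mx A 0 R 1%:M *m block_mx 1%:M (invmx A *m C) 0 S).
  congr (\det _); rewrite mulmx_block !mulmx1 !mul0mx !mulmx0 !addr0 !mul1mx mulKVmx // mulmxA SE; apply/matrixP=> i j; rewrite !mxE.
  by case: splitP => i' ->; rewrite mxE; case: splitP => j' ->; rewrite !mxE.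
by rewrite det_mulmx det_lblock det_ublock !det1 mulr1 mul1r.
Qed.

Lemma detn1 f : detn 1 f = f 0 0.
Proof. by rewrite /detn det_mx11 mxE. Qed.

Lemma detn2 f : detn 2 f = f 0 0 * f 1 1 - f 0 1 * f 1 0.
Proof.
rewrite /detn (expand_det_row _ 0) !big_ord_recl big_ord0 /cofactor !det_mx11 !mxE /=.
by rewrite expr0 expr1 /bump /=; ring.
Qed.
End Schur.

Section Toda.
Variables (F : fieldType) (d : F -> F) (c : nat -> F).
Hypotheses (hd : derivation d) (dc : forall k, d (c k) = c k.+1).

Lemma deriv_det m (A : 'M[F]_m) :
  d (\det A) = \sum_k \det (\matrix_(i, j) if i == k then d (A i j) else A i j).
Proof.
pose G (k : 'I_m) (s : 'S_m) := (-1) ^+ s * \prod_i (if i == k then d (A i (s i)) else A i (s i)).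
rewrite (der_sum hd) (eq_bigr (fun s : 'S_m => \sum_k G k s)) => [|s _].
  rewrite exchange_big; apply: eq_bigr => k _; apply: eq_bigr => s _.
  by rewrite /G; congr (_ * _); apply: eq_bigr => i _; rewrite mxE.
rewrite derM // (_ : d ((-1) ^+ s) = 0) ?mul0r ?add0r; last first.
  by case: (odd_perm s); rewrite ?expr1 ?expr0 ?(derN hd) (der_1 hd) ?oppr0.
rewrite -mulr_sumr; congr (_ * _).
have gen (r : seq 'I_m) : uniq r -> d (\prod_(i <- r) A i (s i)) =
    \sum_(k <- r) \prod_(i <- r) (if i == k then d (A i (s i)) else A i (s i)).
  elim: r => [|x r IH] /=; first by rewrite !big_nil (der_1 hd).
  case/andP=> xr /IH {}IH; rewrite !big_cons derM // IH eqxx; congr (_ * _ + _).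
    by apply: eq_big_seq => i ir; case: eqP ir xr => // -> ->.
  rewrite mulr_sumr; apply: eq_big_seq => k kr; rewrite big_cons.
  by case: eqP kr xr => // -> ->.
by apply: gen; apply: index_enum_uniq.
Qed.

(* The Hankel determinant of size m.+1 whose last row and column are moved to the
   indices x and y. *)
Definition hankel m x y := detn m.+1 (fun i j : nat => c ((if i < m then i else x) + (if j < m then j else y))%N).

(** Differentiating a row raises its index by one, which repeats the next row and kills the
    determinant, except for the last row. For row m - 1 the next row is the last one, which is why
    its index must be m. *)
Lemma d_hankel m y : d (hankel m m y) = hankel m m.+1 y.
Proof.
rewrite /hankel /detn deriv_det (bigD1 ord_max) //= big1 ?addr0 => [|k kmax].
  congr (\det _); apply/matrixP=> i j; rewrite !mxE.
  case: eqP => [->|/eqP im]; first by rewrite /= ltnn dc addSn.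
  by have -> : (i < m)%N by rewrite ltn_neqAle -ltnS ltn_ord andbT.
have km : (k < m)%N by rewrite ltn_neqAle -ltnS ltn_ord andbT.
have k1 : (k.+1 < m.+1)%N by [].
apply: (@determinant_alternate _ _ _ k (Ordinal k1)).
  by rewrite -val_eqE /= neq_ltn leqnn.
move=> j; rewrite !mxE eqxx km -val_eqE /= eqn_leq ltnn dc -addSn.
case: (ltnP k.+1 m) => //= mk; congr (c (_ + _)%N); apply/eqP.
by rewrite eqn_leq km mk.
Qed.

Lemma hankelC m x y : hankel m x y = hankel m y x.
Proof. by rewrite /hankel detn_tr; apply: eq_detn => i j _ _; rewrite addnC. Qed.

Lemma hankel_diag m : hankel m m m = detn m.+1 (fun i j => c (i + j)%N).
Proof.
apply: eq_detn => i j im jm.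
have h k : (k < m.+1)%N -> (if (k < m)%N then k else m) = k.
  by rewrite ltnS; case: ltnP => // mk km; apply/eqP; rewrite eqn_leq mk.
by rewrite !h.
Qed.

(** With g the Schur complement of the leading block of size m, every determinant here is [H m]
    times an entry or a 2 x 2 minor of g, and the equation is the expansion of that minor
    (Desnanot-Jacobi). Symmetry lets the derivative act on rows, then on columns. *)
Lemma hankel_toda m (H := fun m => detn m (fun i j => c (i + j)%N)) : H m != 0 ->
  H m.+2 * H m = H m.+1 * d (d (H m.+1)) - d (H m.+1) ^+ 2.
Proof.
move=> Hm.
pose g x y := c (x + y)%N - \sum_(k < m) \sum_(l < m)
   c (x + k)%N * invmx (\matrix_(i < m, j < m) c (i + j)%N) k l * c (l + y)%N.
have hg x y : hankel m x y = H m * g x y.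
  rewrite /hankel -addn1 detn_schur; last first.
    by rewrite (eq_detn (f' := fun i j => c (i + j)%N)) // => i j -> ->.
  congr (_ * _); first by apply: eq_detn => i j -> ->.
  rewrite detn1 /schur !addn0 ltnn; congr (_ - _).
  apply: eq_bigr => k _; apply: eq_bigr => l _; rewrite !ltn_ord; congr (_ * invmx _ _ _ * _).
  by apply/matrixP=> i j; rewrite !mxE !ltn_ord.
have H2 : H m.+2 = H m * (g m m * g m.+1 m.+1 - g m m.+1 * g m.+1 m).
  by rewrite /H -(addn2 m) detn_schur // detn2 !addn0 !addn1.
have dH : d (H m.+1) = H m * g m.+1 m by rewrite /H -hankel_diag d_hankel hg.
have dH' : d (H m.+1) = H m * g m m.+1 by rewrite /H -hankel_diag d_hankel hankelC hg.
have ddH : d (d (H m.+1)) = H m * g m.+1 m.+1.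
  by rewrite /H -hankel_diag d_hankel hankelC d_hankel hg.
have H1 : H m.+1 = H m * g m m by rewrite /H -hankel_diag hg.
by rewrite ddH expr2 {1}dH dH' H1 H2; ring.
Qed.
End Toda.

(** * Moments of the deformed Laguerre weight *)

Definition euler (R : comNzRingType) (p : {poly R}) := 'X * p^`().

Lemma euler_derivation (R : comNzRingType) : derivation (@euler R).
Proof. by split=> p q; rewrite /euler ?derivE; ring. Qed.

Lemma coef_euler (R : comNzRingType) (p : {poly R}) i : (euler p)`_i = i%:R * p`_i.
Proof. by rewrite /euler coefXM; case: i => [|i]; rewrite ?mul0r // coef_deriv mulr_natl. Qed.

Definition rising (R : comNzRingType) (al k : nat) : R := \prod_(i < k) (al + 1 + i)%:R.

Lemma risingS (R : comNzRingType) al k : rising R al k.+1 = (al + 1 + k)%:R * rising R al k.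
Proof. by rewrite /rising big_ord_recr mulrC. Qed.

Section Laguerre.
Variables al M : nat.

Local Notation rising := (rising rat al).

Lemma rising_neq0 k : rising k != 0.
Proof. by apply/prodf_neq0 => i _; rewrite pnatr_eq0 addn1. Qed.

(* The image of x^k (1 - s x)^M under the functional x^j |-> (al + 1)_j, that is
   integration against x^al exp(-x) / al! over the half-line. *)
Definition moment k : {poly rat} :=
  \poly_(j < M.+1) ((-1) ^+ j * 'C(M, j)%:R * rising (k + j)).

Lemma coef_moment k j : (moment k)`_j = (-1) ^+ j * 'C(M, j)%:R * rising (k + j).
Proof. by rewrite coef_poly ltnS; case: leqP => // h; rewrite bin_small // mulr0 mul0r. Qed.

Lemma momentS k : moment k.+1 = euler (moment k) + (al + 1 + k)%:R * moment k.
Proof.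
apply/polyP=> j; rewrite coefD coef_euler -polyC_natr coefCM.
by rewrite !coef_moment addSn risingS !natrD; ring.
Qed.

(** The integral of the derivative of x^(al+1) (1 - s x)^(M+1) exp(-x) vanishes; this is that
    identity, read on coefficients. *)
Lemma moment_pearson : 'X * moment 2 =
  ((al + M + 2)%:R * 'X + 1) * moment 1 - (al.+1)%:R * moment 0.
Proof.
apply/polyP=> -[|j].
  rewrite coefXM coefB mulrDl coefD mul1r -mulrA -!polyC_natr !coefCM coefXM /= !coef_moment.
  by rewrite addn0 risingS -addn1 addn0; ring.
rewrite coefXM coefB mulrDl coefD mul1r -mulrA -!polyC_natr !coefCM coefXM /= !coef_moment.
rewrite add0n add1n add2n !risingS.
have h : ('C(M, j.+1))%:R * (j.+1)%:R = (M%:R - j%:R) * ('C(M, j))%:R :> rat.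
  case: (leqP j M) => jM; last by rewrite !bin_small ?mulr0 ?mul0r // ltnW.
  by rewrite -natrM mulnC mul_bin_left natrM natrB.
apply/eqP; rewrite -subr_eq0; apply/eqP.
rewrite -natr1 in h; rewrite (exprS _ j) !natrD -[al.+1%:R]natr1.
transitivity ((-1) ^+ j * rising j * (al%:R + 1 + j%:R) * (
  'C(M, j.+1)%:R * (j%:R + 1) - (M%:R - j%:R) * ('C(M, j))%:R)); last by rewrite h subrr mulr0.
by ring.
Qed.

Definition hdet N := detn N (fun i j => moment (i + j)%N).

Let fr : {poly rat} -> {fraction {poly rat}} := @FracField.tofrac _.
Let th := frac_deriv (@euler rat).
Let hth : derivation th := frac_derivation (euler_derivation rat).
Let d (x : {fraction {poly rat}}) := fr 'X * th x.
Let dp (p : {poly rat}) := 'X * euler p.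

Let d_fr p : d (fr p) = fr (dp p).
Proof. by rewrite /d /th /fr frac_deriv_tofrac ?tofracM //; exact: euler_derivation. Qed.

(* The power of s makes [C k] the derivatives of [C 0] for s^2 d/ds; it is
   responsible for the factor [s ^ (N * (N + al))] of [hp]. *)
Let C k := 'X^(al + 1 + k) * moment k.

Let euler_Xn k (p : {poly rat}) : euler ('X^k * p) = 'X^k * (k%:R * p + euler p).
Proof.
have eX : euler 'X = 'X :> {poly rat} by rewrite /euler derivX mulr1.
have hE := euler_derivation rat; rewrite (derM hE) (derX hE) eX.
by case: k => [|k] /=; rewrite ?exprS; ring.
Qed.

Let dp_C k : dp (C k) = C k.+1.
Proof. by rewrite /dp /C euler_Xn (addnS _ k) (exprS _ (_ + k)) momentS; ring. Qed.

Lemma detn_map (R S : comNzRingType) (f : {rmorphism R -> S}) m g :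
  f (detn m g) = detn m (fun i j => f (g i j)).
Proof. by rewrite /detn -det_map_mx; congr (\det _); apply/matrixP=> i j; rewrite !mxE. Qed.

Lemma detn_scale (R : comNzRingType) m (f g : nat -> R) h :
  detn m (fun i j => f i * g j * h i j) = (\prod_(i < m) f i) * (\prod_(i < m) g i) * detn m h.
Proof.
pose D (k : nat -> R) := diag_mx (\row_(i < m) k i).
have dD k : \det (D k) = \prod_(i < m) k i by rewrite det_diag; apply: eq_bigr => i _; rewrite mxE.
rewrite -!dD mulrAC /detn -!det_mulmx; congr (\det _); apply/matrixP=> i j.
by rewrite mul_mx_diag mul_diag_mx !mxE; ring.
Qed.

Let hp N := 'X^(N * (N + al)) * hdet N.

Let hpE N : detn N (fun i j => C (i + j)) = hp N.
Proof.
rewrite -[LHS](@eq_detn _ N (fun i j => 'X^(al + 1 + i) * 'X^j * moment (i + j)%N)) => [|i j _ _].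
  rewrite detn_scale -big_split /=; congr (_ * _).
  rewrite (eq_bigr (fun i : 'I_N => 'X^(al + 1 + i + i))) => [|i _]; last by rewrite -exprD.
  rewrite prodrXr; congr ('X^_).
  by elim: N => [|N IH]; [rewrite big_ord0 | rewrite big_ord_recr /= IH; nia].
by rewrite /C -exprD addnA.
Qed.

Let dpX k (p : {poly rat}) : dp ('X^k * p)%R = 'X^(k.+1) * (k%:R * p + euler p).
Proof. by rewrite /dp euler_Xn mulrA -exprS. Qed.

Let H N := detn N (fun i j => fr (C (i + j))).
Let HE N : H N = fr (hp N).
Proof. by rewrite -hpE /fr (detn_map (@FracField.tofrac {poly rat})). Qed.

Let H_toda N : hdet N != 0 -> H N.+2 * H N = H N.+1 * d (d (H N.+1)) - d (H N.+1) ^+ 2.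
Proof.
move=> h; apply: (@hankel_toda _ d (fun k => fr (C k))).
- exact: derivation_scale.
- by move=> k; rewrite d_fr dp_C.
- rewrite -[detn _ _]/(H N) HE tofrac_eq0 mulf_neq0 //.
  by rewrite expf_neq0 // polyX_eq0.
Qed.

Let hp_toda N : hdet N != 0 -> hp N.+2 * hp N = hp N.+1 * dp (dp (hp N.+1)) - dp (hp N.+1) ^+ 2.
Proof.
move/H_toda; rewrite !HE !d_fr -!tofracM -tofracXn -tofracB => /eqP.
by rewrite tofrac_eq => /eqP.
Qed.

Let hdet_toda N (k := (N.+1 * (N.+1 + al))%N) (q := k%:R * hdet N.+1 + euler (hdet N.+1)) :
  hdet N != 0 -> hdet N.+2 * hdet N = hdet N.+1 * (k.+1%:R * q + euler q) - q ^+ 2.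
Proof.
move=> /hp_toda; rewrite /hp -/k !dpX -/q => h.
(* Both sides of [hp_toda] carry this power, since (N+2)(N+2+al) + N(N+al) = 2 (k + 1). *)
have X0 : 'X^(2 * k.+1) != 0 :> {poly rat} by rewrite expf_neq0 // polyX_eq0.
apply: (mulfI X0).
transitivity ('X^(N.+2 * (N.+2 + al)) * hdet N.+2 * ('X^(N * (N + al)) * hdet N)).
  by rewrite [RHS]mulrACA -exprD; congr ('X^_ * _); rewrite /k; lia.
by rewrite h mul2n -addnn exprD !exprS; ring.
Qed.

(** At s = 0 the Toda equation reads h(N+2) h(N) = k h(N+1)^2 with k = (N+1)(N+1+al) > 0. As it
    presupposes [hdet N != 0], nonvanishing is carried along for two consecutive sizes. *)
Lemma hdet_coef0 N : (hdet N)`_0 != 0.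
Proof.
suff : (hdet N)`_0 != 0 /\ (hdet N.+1)`_0 != 0 by case.
elim: N => [|N [h0 h1]].
  by rewrite /hdet /detn det_mx00 coef1 det_mx11 mxE coef_moment bin0 expr0 !mul1r rising_neq0.
split=> //; have := hdet_toda (N := N).
have hN : hdet N != 0 by apply: contraNneq h0 => ->; rewrite coef0.
set k := (N.+1 * _)%N => /(_ hN) /(congr1 (fun p : {poly rat} => p`_0)).
set q := k%:R * _ + _.
have q0 : q`_0 = k%:R * (hdet N.+1)`_0.
  by rewrite /q coefD coef_euler mul0r addr0 -polyC_natr coefCM.
rewrite coefB expr2 !coef0M coefD coef_euler mul0r addr0 -polyC_natr coefCM q0 => h.
apply/eqP=> h2; move/eqP: h; rewrite h2 mul0r eq_sym => /eqP h.
have : k%:R * (hdet N.+1)`_0 ^+ 2 = 0 by rewrite -[RHS]h -[k.+1%:R]natr1; ring.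
by apply/eqP; rewrite mulf_neq0 ?expf_neq0 // pnatr_eq0.
Qed.

Lemma hdet_neq0 N : hdet N != 0.
Proof. by apply: contraNneq (hdet_coef0 N) => ->; rewrite coef0. Qed.

Theorem hdet_bilin N : bilin (@euler rat) 'X (- M%:R) N%:R (N + al)%:R (hdet N) = 0.
Proof.
have e p : th (fr p) = fr (euler p) by apply: frac_deriv_tofrac; exact: euler_derivation.
have HX n : H n = fr 'X ^+ (n * (n + al)) * fr (hdet n) by rewrite HE /hp /fr tofracM tofracXn.
apply/eqP; rewrite -tofrac_eq0; apply/eqP.
rewrite (bilin_rmorph (f := @FracField.tofrac {poly rat}) (th' := th)) ?rmorphN ?rmorph_nat //.
apply: (@toda_bilin _ th (fr 'X) al M (fun n => fr (hdet n)) hth).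
- by rewrite tofrac_eq0 polyX_eq0.
- by rewrite e /euler derivX mulr1.
- by rewrite mul0n expr0 mul1r /hdet /detn det_mx00 /fr tofrac1.
- by move=> n; rewrite tofrac_eq0 hdet_neq0.
- by move=> n; rewrite -!HX; apply: H_toda (hdet_neq0 n).
rewrite -HX HE -hpE /detn det_mx11 mxE -!/(d _) !d_fr !dp_C.
have -> : C 2 = ((al + M + 2)%:R * 'X + 1) * C 1 - (al.+1)%:R * 'X * C 0.
  transitivity ('X^(al + 1 + 1) * ('X * moment 2)); first by rewrite /C (addnS _ 1) (exprS _ (_ + 1)); ring.
  by rewrite moment_pearson /C addn0 (addnS _ 0) (exprS _ (_ + 0)) addn0; ring.
by rewrite /fr !(rmorphD, rmorphB, rmorphN, rmorphM, rmorph_nat, rmorph1).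
Qed.
End Laguerre.

(** * The Laguerre functional in several variables *)

Section Functional.
Variables (K : idomainType) (N al : nat).
Local Notation P := {mpoly K[N]}.

(** The mean of a monomial for independent variables of density x^al exp(-x) / al!; [laguerre]
    extends it linearly. *)
Definition mnm_moment (m : 'X_{1..N}) : K := \prod_i rising K al (m i).
Definition laguerre (p : P) : K := \sum_(m <- msupp p) p@_m * mnm_moment m.

Lemma laguerre_wE k p : (msize p <= k)%N -> laguerre p = \sum_(m : 'X_{1..N < k}) p@_m * mnm_moment m.
Proof.
move=> le_pk; pose I := 'X_{1..N < k}; rewrite /laguerre.
rewrite (big_mksub I) ?msupp_uniq //=; last first.
  by move=> x /msize_mdeg_lt /leq_trans -> //.
by rewrite big_rmcond //= => m /memN_msupp_eq0 ->; rewrite mul0r.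
Qed.

Lemma laguerre_linear : linear_for *%R laguerre.
Proof.
move=> c p q; pose k := maxn (msize (c *: p + q)) (maxn (msize p) (msize q)).
rewrite !(@laguerre_wE k) /k ?leq_max ?leqnn ?orbT // mulr_sumr -big_split; apply: eq_bigr => m _.
by rewrite mcoeffD mcoeffZ /=; ring.
Qed.

HB.instance Definition _ := GRing.isLinear.Build K P K *%R laguerre laguerre_linear.

Lemma laguerre_X m : laguerre 'X_[m] = mnm_moment m.
Proof. by rewrite /laguerre msuppX big_seq1 mcoeffX eqxx mul1r. Qed.

Lemma laguerre_C c p : laguerre (c%:MP * p) = c * laguerre p.
Proof. by rewrite mul_mpolyC linearZ. Qed.

(* Integration by parts against x_i^al exp(-x_i). *)
Lemma laguerre_ibp i (p : P) : laguerre ('X_i * p) = (al + 1)%:R * laguerre p + laguerre ('X_i * p^`M(i)).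
Proof.
rewrite (mpolyE p) mulr_sumr !linear_sum /= mulr_sumr mulr_sumr linear_sum -big_split /=.
apply: eq_bigr => m _; rewrite mderivZ mderivX -!mul_mpolyC !(mulrCA 'X_i) !laguerre_C.
rewrite -!mpolyXD !laguerre_X.
have hU (m' : 'X_{1..N}) : mnm_moment (U_(i) + m') = (al + 1 + m' i)%:R * mnm_moment m'.
  rewrite /mnm_moment (bigD1 i) // [in RHS](bigD1 i) //= mnmDE mnm1E eqxx add1n risingS mulrA.
  congr (_ * _); apply: eq_bigr => j ji; rewrite mnmDE mnm1E eq_sym (negPf ji) //.
rewrite hU; case: (posnP (m i)) => [-> | mi]; first by rewrite addn0; ring.
rewrite addmC submK; first by rewrite natrD; ring.
by apply/mnm_lepP => l; rewrite mnm1E; case: eqP => // <-.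
Qed.

Lemma laguerre_prod n (c : nat -> K) (e : 'I_N -> nat) :
  laguerre (\prod_i \sum_(j < n) c j *: 'X_i ^+ (e i + j)) =
  \prod_i \sum_(j < n) c j * rising K al (e i + j).
Proof.
rewrite !bigA_distr_bigA linear_sum; apply: eq_bigr => /= f _.
rewrite -[RHS]mulr1 scaler_prod linearZ /= big_split /= mulr1; congr (_ * _).
have -> : \prod_i 'X_i ^+ (e i + f i) = 'X_[[multinom (e i + f i)%N | i < N]] :> P.
  by rewrite mpolyXE_id; apply: eq_bigr => i _; rewrite mnmE.
by rewrite laguerre_X; apply: eq_bigr => i _; rewrite mnmE.
Qed.
End Functional.

Section Vdm.
Variables (K : idomainType) (N : nat).
Local Notation P := {mpoly K[N]}.
Local Notation pr := ('I_N * 'I_N)%type.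

(** The product over ordered pairs is the squared Vandermonde determinant up to sign, and
    [disc_but a b] is its quotient by ['X_a - 'X_b], obtained without division. *)
Definition disc : P := \prod_(ij : pr | ij.1 != ij.2) ('X_ij.1 - 'X_ij.2).
Definition disc_but (a b : 'I_N) : P :=
  \prod_(ij : pr | (ij.1 != ij.2) && (ij != (a, b))) ('X_ij.1 - 'X_ij.2).

Lemma disc_butE a b : a != b -> disc = ('X_a - 'X_b) * disc_but a b.
Proof. by move=> ab; rewrite /disc (bigD1 (a, b)). Qed.

Lemma subX_neq0 (a b : 'I_N) : a != b -> 'X_a - 'X_b != 0 :> P.
Proof.
move=> ab; rewrite subr_eq0; apply/eqP => /(congr1 (mcoeff U_(a))) /eqP.
by rewrite !mcoeffXU eqxx eq_sym [b == a]eq_sym (negPf ab) eq_sym oner_eq0.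
Qed.

Lemma disc_butC a b : a != b -> disc_but b a = - disc_but a b.
Proof.
move=> ab; apply: (mulfI (subX_neq0 ab)); rewrite mulrN -disc_butE //.
by rewrite -opprB mulNr -disc_butE // eq_sym.
Qed.

Lemma mderiv_Xi (a b : 'I_N) : ('X_b : P)^`M(a) = (b == a)%:R.
Proof.
rewrite mderivX mnm1E; case: eqP => [->|_]; last by rewrite scale0r.
rewrite (_ : U_(a) - U_(a) = 0)%MM ?mpolyX0 ?scale1r //.
by apply/mnmP=> j; rewrite mnmBE subnn mnm0E.
Qed.

Lemma mderiv_prod (I : eqType) (r : seq I) (F : I -> P) (a : 'I_N) : uniq r ->
  (\prod_(i <- r) F i)^`M(a) =
  \sum_(i <- r) (F i)^`M(a) * \prod_(k <- r | k != i) F k.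
Proof.
elim: r => [|x r IH] /=; first by rewrite !big_nil -mpolyC1 mderivC.
case/andP=> xr /IH {}IH; rewrite !big_cons mderivM IH eqxx /=; congr (_ * _ + _).
  rewrite [RHS]big_seq_cond [LHS]big_seq; apply: eq_bigl => k.
  by case: eqP => [->|]; rewrite ?(negPf xr) ?andbT.
rewrite mulr_sumr [LHS]big_seq [RHS]big_seq; apply: eq_bigr => k kr.
by rewrite big_cons; case: eqP kr xr => [-> -> //|_ _ _]; rewrite mulrCA.
Qed.

(** The factors of (a, b) and (b, a) contribute equally, hence the 2. *)
Lemma mderiv_disc a : disc^`M(a) = \sum_(b | b != a) 2%:R * disc_but a b.
Proof.
rewrite /disc -big_filter mderiv_prod ?filter_uniq ?index_enum_uniq // big_filter.
transitivity (\sum_(ij : pr | ij.1 != ij.2) ((ij.1 == a)%:R - (ij.2 == a)%:R) * disc_but ij.1 ij.2).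
  apply: eq_bigr => -[i j] /= ij; rewrite mderivB !mderiv_Xi; congr (_ * _).
  by rewrite big_filter_cond.
rewrite (eq_bigr (fun ij : pr => (ij.1 == a)%:R * disc_but ij.1 ij.2
  - (ij.2 == a)%:R * disc_but ij.1 ij.2)) => [|ij _]; last by rewrite mulrBl.
have pb (F : 'I_N -> 'I_N -> P) :
    \sum_(ij : pr | ij.1 != ij.2) F ij.1 ij.2 = \sum_i \sum_(j | i != j) F i j.
  rewrite big_mkcond -(pair_bigA _ (fun i j => if i != j then F i j else 0)).
  by apply: eq_bigr => i _; rewrite -big_mkcond.
rewrite sumrB (pb (fun i j => (i == a)%:R * disc_but i j)) (pb (fun i j => (j == a)%:R * disc_but i j)).
have -> : \sum_i \sum_(j | i != j) (i == a)%:R * disc_but i j = \sum_(b | b != a) disc_but a b.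
  rewrite (bigD1 a) //= [X in _ + X]big1 ?addr0 => [|i ia]; last first.
    by apply: big1 => j _; rewrite (negPf ia) mul0r.
  by apply: eq_big => [j|j _]; rewrite 1?eq_sym ?eqxx ?mul1r.
have -> : \sum_i \sum_(j | i != j) (j == a)%:R * disc_but i j = \sum_(b | b != a) disc_but b a.
  rewrite [RHS]big_mkcond; apply: eq_bigr => i _.
  case: (eqVneq i a) => [->|ia] /=.
    by apply: big1 => j ja; rewrite eq_sym (negPf ja) mul0r.
  rewrite (bigD1 a) //= eqxx mul1r big1 ?addr0 // => j /andP[_ ja].
  by rewrite (negPf ja) mul0r.
rewrite -sumrB; apply: eq_bigr => b ba; rewrite [disc_but b a]disc_butC 1?eq_sym //; ring.
Qed.
End Vdm.

(** * Permutation pairs and the Laguerre ensemble *)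

Section Colourings.
Variables (K : idomainType) (N al : nat) (T : finType).
Local Notation P := {mpoly K[N]}.
Local Notation C := {ffun T -> 'I_N}.
Implicit Types (f : C) (pi : {perm T}).

Definition cinv f pi := [forall i, f (pi i) == f i].
(** This is the product, over the cycles of pi, of the power sums of the cycle lengths. Written with
    colourings, it allows a single point of a cycle to be removed. *)
Definition colour_sum pi : P := \sum_(f | cinv f pi) \prod_i 'X_(f i).
Definition upd f k c : C := [ffun i => if i == k then c else f i].

Lemma cinvP f pi : reflect (forall i, f (pi i) = f i) (cinv f pi).
Proof. by apply: (iffP forallP) => h i; apply/eqP. Qed.

Variables (o : T) (pi : {perm T}).

Definition mon f : P := \prod_(i | i != o) 'X_(f i).
Definition colour_sum_but pi : P := \sum_(f | cinv f pi) mon f.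

(* For j <> o, [jump j] merges the cycles of o and j, or splits their common cycle. *)
Definition jump j := (tperm o j * pi)%g.

Let A a : P := \sum_(f | cinv f pi && (f o == a)) mon f.

(* Colourings of the path obtained by cutting the cycle of o at o and at j: the colour is
   a from [pi j] up to o and becomes b after o, up to j.  Recolouring [pi j] moves the cut
   one step further, so the sum over j telescopes to the divided difference of
   [cut_sum]: this is how the derivative of the squared Vandermonde produces the
   permutations [jump j]. *)
Definition cut a b j f :=
  [&& f o == a, upd f o b j == b, f (pi j) == a & [forall i, (i != j) ==> (f (pi i) == upd f o b i)]].

Lemma cutP a b j f : reflect
  [/\ f o = a, upd f o b j = b, f (pi j) = a & forall i, i != j -> f (pi i) = upd f o b i]
  (cut a b j f).
Proof.
apply: (iffP and4P) => -[h1 h2 h3 h4]; split; try exact/eqP.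
  by move=> i ij; apply/eqP; move/forallP: h4 => /(_ i); rewrite ij.
by apply/forallP=> i; apply/implyP=> ij; apply/eqP/h4.
Qed.

Let U a b j : P := \sum_(f | cut a b j f) mon f.

Lemma updE f k c i : upd f k c i = if i == k then c else f i.
Proof. by rewrite ffunE. Qed.

Lemma upd_upd f k c c' : upd (upd f k c) k c' = upd f k c'.
Proof. by apply/ffunP=> i; rewrite !updE; case: eqP. Qed.

Lemma upd_id f k c : f k = c -> upd f k c = f.
Proof. by move=> h; apply/ffunP=> i; rewrite !updE; case: eqP => // ->. Qed.

Lemma mon_upd_o f c : mon (upd f o c) = mon f.
Proof. by apply: eq_bigr => i io; rewrite updE (negPf io). Qed.

Lemma mon_upd f k c : k != o -> 'X_(f k) * mon (upd f k c) = 'X_c * mon f.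
Proof.
move=> ko; rewrite /mon (bigD1 k) //= updE eqxx [in RHS](bigD1 k) //= mulrCA.
congr (_ * (_ * _)); apply: eq_bigr => i /andP[_ ik]; by rewrite updE (negPf ik).
Qed.

Lemma cut_step a b j : a != b -> pi j != o -> 'X_b * U a b j = 'X_a * U a b (pi j).
Proof.
move=> ab ko; set k := pi j in ko *; rewrite /U !mulr_sumr.
rewrite (reindex_onto (fun g => upd g k a) (fun f => upd f k b)) /=; last first.
  by move=> f /cutP[_ _ h _]; rewrite upd_upd upd_id.
apply: eq_big => [g|g /andP[_ /eqP e]]; last first.
  have gk : g k = b by rewrite -e upd_upd updE eqxx.
  by rewrite -gk mon_upd.
rewrite upd_upd; apply/idP/idP.
  case/andP=> /cutP[]; rewrite !updE eqxx eq_sym (negPf ko) => h1 h2 _ h4 /eqP e.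
  have gk : g k = b by rewrite -e updE eqxx.
  apply/cutP; split=> //; first by rewrite updE (negPf ko).
    have [kj|kj] := eqVneq k j.
      by move: h2 ab; rewrite -kj (negPf ko) eqxx => ->; rewrite eqxx.
    have := h4 k kj; rewrite !updE (negPf ko) eqxx.
    by have -> : pi k == k = false by apply/negbTE; apply: contra kj => /eqP/perm_inj ->.
  move=> i ik; have [ij|ij] := eqVneq i j.
    by rewrite ij -/k gk updE; move: h2; rewrite -ij (negPf ik); case: (i == o).
  have := h4 i ij; rewrite !updE (negPf ik).
  by have -> : pi i == k = false by apply/negbTE; apply: contra ij => /eqP/perm_inj ->.
case/cutP=> h1; rewrite updE (negPf ko) => h2 h3 h4.
apply/andP; split; last by rewrite upd_id.
have kj : k != j.
  by apply: contra ab => /eqP kj; rewrite -h3 -h2 kj -/k kj.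
apply/cutP; split; [| |by rewrite updE eqxx|].
- by rewrite updE eq_sym (negPf ko).
- rewrite !updE [j == k]eq_sym (negPf kj).
  by have := h4 j; rewrite eq_sym kj -/k h2 updE => /(_ isT) <-.
move=> i ij; rewrite !updE.
have -> : pi i == k = false by apply/negbTE; apply: contra ij => /eqP/perm_inj ->.
have [->|ik] := eqVneq i k; first by rewrite (negPf ko).
by rewrite h4 // updE.
Qed.

Lemma cut_last a b j : pi j = o -> U a b j = A b.
Proof.
move=> jo; rewrite /U /A (reindex_onto (fun g => upd g o a) (fun f => upd f o b)) /=; last first.
  by move=> f /cutP[h _ _ _]; rewrite upd_upd upd_id.
apply: eq_big => [g|g _]; last by rewrite mon_upd_o.
rewrite upd_upd; apply/idP/idP.
  case/andP=> /cutP[]; rewrite upd_upd => h1 h2 h3 h4 /eqP e.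
  rewrite e in h2 h4; have go : g o = b by rewrite -e updE eqxx.
  rewrite go eqxx andbT; apply/cinvP=> i; have [->|ij] := eqVneq i j; first by rewrite jo go h2.
  rewrite -[RHS]h4 // updE; case: eqP => // /esym; rewrite -jo => /perm_inj ji.
  by rewrite ji eqxx in ij.
case/andP=> /cinvP gi /eqP go; rewrite (upd_id go) eqxx andbT.
apply/cutP; rewrite upd_upd (upd_id go) updE eqxx; split=> //; first by rewrite -go -gi jo.
  by rewrite jo updE eqxx.
move=> i ij; rewrite updE; case: eqP => [|_]; last exact: gi.
by rewrite -jo => /perm_inj ji; rewrite ji eqxx in ij.
Qed.

Lemma cut_o a b : U a b o = A a.
Proof.
apply: eq_bigl => f; apply/idP/idP.
  case/cutP=> h1 h2 h3 h4; rewrite h1 eqxx andbT; apply/cinvP=> i.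
  have [->|io] := eqVneq i o; first by rewrite h1.
  by rewrite h4 // updE (negPf io).
case/andP=> /cinvP fi /eqP fo; apply/cutP; rewrite fi updE eqxx; split=> //.
by move=> i io; rewrite fi updE (negPf io).
Qed.

Lemma cut_jump a b j : j != o ->
  U a b j = \sum_(f | [&& cinv f (jump j), f o == a & f j == b]) mon f.
Proof.
move=> jo; apply: eq_bigl => f; apply/idP/idP.
  case/cutP=> h1; rewrite updE (negPf jo) => h2 h3 h4; rewrite h1 h2 !eqxx !andbT.
  apply/cinvP=> i; rewrite permM; case: tpermP => [->|->|/eqP io /eqP ij].
  - by rewrite h3.
  - by rewrite h4 1?eq_sym // updE eqxx.
  - by rewrite h4 // updE (negPf io).
case/and3P=> /cinvP fi /eqP h1 /eqP h2; apply/cutP; split=> //.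
- by rewrite updE (negPf jo).
- by have := fi o; rewrite permM tpermL => ->.
move=> i ij; rewrite updE; case: eqP => [->|/eqP io].
  by have := fi j; rewrite permM tpermR => ->.
by have := fi i; rewrite permM tpermD // eq_sym.
Qed.

Let S a b := \sum_j U a b j.

Lemma cut_sum a b : a != b -> ('X_a - 'X_b) * S a b = 'X_a * A a - 'X_b * A b.
Proof.
move=> ab; have e : 'X_b * S a b = 'X_b * A b + 'X_a * (S a b - A a).
  rewrite {1}/S mulr_sumr (bigD1 (pi^-1%g o)) //= cut_last ?permKV //; congr (_ + _).
  rewrite [S a b](bigD1 o) //= cut_o addrC addrK mulr_sumr.
  rewrite [RHS](reindex_inj (@perm_inj _ pi)) /=; apply: eq_big => [j|j jo].
    by rewrite -(inj_eq (@perm_inj _ pi)) permKV.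
  by apply: cut_step => //; rewrite -(inj_eq (@perm_inj _ pi)) permKV in jo.
by rewrite mulrBl e; ring.
Qed.

Lemma colour_sum_but_split rho : colour_sum_but rho = \sum_a \sum_(f | cinv f rho && (f o == a)) mon f.
Proof. by rewrite /colour_sum_but (partition_big (fun f => f o) xpredT). Qed.

Lemma colour_sum_split : colour_sum pi = \sum_a 'X_a * A a.
Proof.
rewrite /colour_sum (partition_big (fun f => f o) xpredT) //=; apply: eq_bigr => a _.
rewrite mulr_sumr; apply: eq_bigr => f /andP[_ /eqP <-].
by rewrite (bigD1 o).
Qed.

Lemma mderiv_mon f a : 'X_a * (mon f)^`M(a) = \sum_(j | (j != o) && (f j == a)) mon f.
Proof.
rewrite /mon -big_filter mderiv_prod ?filter_uniq ?index_enum_uniq // mulr_sumr [LHS]big_filter.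
rewrite [RHS]big_mkcondr; apply: eq_bigr => j jo.
rewrite mderiv_Xi; case: eqP => [fj|_]; last by rewrite mul0r mulr0.
by rewrite mul1r [X in _ * X]big_filter_cond [RHS]big_filter [RHS](bigD1 j) //= fj.
Qed.

Lemma mderiv_A : \sum_a 'X_a * (A a)^`M(a) =
  \sum_(j | j != o) \sum_(f | cinv f pi && (f j == f o)) mon f.
Proof.
under eq_bigr => a _ do rewrite linear_sum mulr_sumr.
rewrite (exchange_big_dep (fun f => cinv f pi)) /=; last by move=> a f _ /andP[].
rewrite [RHS](exchange_big_dep (fun f => cinv f pi)) /=; last by move=> a f _ /andP[].
apply: eq_bigr => f fi; rewrite (big_pred1 (f o)) => [|a]; last by rewrite fi eq_sym.
by rewrite mderiv_mon fi.
Qed.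

(** Since [disc_but] is antisymmetric, averaging over the exchange of a and b turns 2 ['X_a * A a]
    into ['X_a * A a - 'X_b * A b], which [cut_sum] makes divisible by ['X_a - 'X_b]. *)
Lemma mderiv_disc_A : \sum_a 'X_a * ((disc K N)^`M(a) * A a) =
  disc K N * \sum_a \sum_(b | b != a) S a b.
Proof.
pose G a b := 'X_a * A a * disc_but K a b.
transitivity (\sum_a \sum_(b | b != a) (G a b + G a b)).
  apply: eq_bigr => a _; rewrite mderiv_disc mulr_suml mulr_sumr; apply: eq_bigr => b _.
  by rewrite /G; ring.
transitivity (\sum_a \sum_(b | b != a) (G a b + G b a)).
  rewrite (eq_bigr (fun a => \sum_(b | b != a) G a b + \sum_(b | b != a) G a b)); last first.
    by move=> a _; rewrite big_split.
  rewrite [RHS](eq_bigr (fun a => \sum_(b | b != a) G a b + \sum_(b | b != a) G b a)); last first.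
    by move=> a _; rewrite big_split.
  rewrite !big_split /=; congr (_ + _); rewrite (exchange_big_dep xpredT) //=.
  by apply: eq_bigr => b _; apply: eq_bigl => a; rewrite eq_sym.
rewrite mulr_sumr; apply: eq_bigr => a _; rewrite mulr_sumr; apply: eq_bigr => b ba.
have ab : a != b by rewrite eq_sym.
rewrite /G (disc_butC K ab) (disc_butE K ab).
transitivity (('X_a - 'X_b) * S a b * disc_but K a b); last by ring.
by rewrite (cut_sum ab); ring.
Qed.

(** The term j = o is [A a], once for each of the N - 1 other colours b. *)
Lemma sum_S : \sum_a \sum_(b | b != a) S a b = (N%:R - 1) * colour_sum_but pi
  + \sum_(j | j != o) \sum_(f | cinv f (jump j) && (f o != f j)) mon f.
Proof.
have -> : \sum_a \sum_(b | b != a) S a b =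
    \sum_a \sum_(b | b != a) A a + \sum_a \sum_(b | b != a) \sum_(j | j != o) U a b j.
  rewrite -big_split /=; apply: eq_bigr => a _; rewrite -big_split; apply: eq_bigr => b _.
  by rewrite /S (bigD1 o) //= cut_o.
congr (_ + _).
  rewrite colour_sum_but_split mulr_sumr; apply: eq_bigr => a _.
  apply: (addrI (A a)); rewrite -[LHS](bigD1 a (P := xpredT) (F := fun=> A a)) //.
  by rewrite sumr_const card_ord -[LHS]mulr_natl -/(A a); ring.
under eq_bigr => a _ do rewrite exchange_big /=.
rewrite exchange_big /=; apply: eq_bigr => j jo.
rewrite [RHS](partition_big (fun f => f o) xpredT) //=; apply: eq_bigr => a _.
rewrite [RHS](partition_big (fun f => f j) (fun b => b != a)) /=; last first.
  by move=> f /andP[/andP[_ h] /eqP <-]; rewrite eq_sym.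
apply: eq_bigr => b ba; rewrite cut_jump //; apply: eq_bigl => f.
case: (eqVneq (f o) a) => [->|]; rewrite ?andbF //=.
case: (eqVneq (f j) b) => [->|]; rewrite ?andbF //=.
by rewrite eq_sym ba !andbT.
Qed.

(** For colourings with equal colours at o and j, invariance under [jump j] and under pi coincide.
    These come from differentiating the monomial ([mderiv_A]), the others from the Vandermonde
    factor ([sum_S]). *)
Lemma jump_split j : j != o -> colour_sum_but (jump j) =
  \sum_(f | cinv f (jump j) && (f o != f j)) mon f + \sum_(f | cinv f pi && (f j == f o)) mon f.
Proof.
move=> jo; rewrite /colour_sum_but (bigID (fun f => f j == f o)) /= addrC; congr (_ + _).
  by apply: eq_bigl => f; rewrite eq_sym.
apply: eq_bigl => f; case: eqP => [e|]; rewrite ?andbF //= !andbT.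
apply/cinvP/cinvP => h i; last by rewrite permM h; case: tpermP => // ->.
have -> : pi i = jump j (tperm o j i) by rewrite permM tpermK.
by rewrite h; case: tpermP => // ->.
Qed.

(* Integration by parts in the variable coloured at o removes the point o from the
   permutation, exactly as in the recursion [pair_sum_rec]. *)
Theorem colour_tutte : laguerre al (disc K N * colour_sum pi) =
  laguerre al (disc K N * ((al + N)%:R * colour_sum_but pi + \sum_(j | j != o) colour_sum_but (jump j))).
Proof.
(* Here al + N = (al + 1) + (N - 1): the first part comes from the weight, the second from the
   Vandermonde factor. *)
have -> : (al + N)%:R * colour_sum_but pi + \sum_(j | j != o) colour_sum_but (jump j) =
   (al + 1)%:R * colour_sum_but pi + \sum_a \sum_(b | b != a) S a b + \sum_a 'X_a * (A a)^`M(a).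
  rewrite mderiv_A sum_S -addrA -addrA -big_split /= addrA; congr (_ + _).
    by rewrite !natrD; ring.
  by apply: eq_bigr => j; apply: jump_split.
rewrite mulrDr mulrDr -mderiv_disc_A colour_sum_split colour_sum_but_split.
rewrite !mulr_sumr !linearD !linear_sum -!big_split /=; apply: eq_bigr => a _.
rewrite (mulrCA (disc K N) 'X_a) (laguerre_ibp al a (disc K N * A a)) mderivM mulrDr linearD /= addrA; congr (_ + _ + _).
  by rewrite -(laguerre_C al) mpolyC_nat mulrCA.
by congr (laguerre _ _); ring.
Qed.
End Colourings.

(** * Inserting and removing a point of a permutation *)

Definition cyc (T : finType) (s : {perm T}) := #|porbits s|.

Lemma cycV (T : finType) (s : {perm T}) : cyc s^-1 = cyc s.
Proof. by rewrite /cyc porbitsV. Qed.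

Lemma cyc_perm0 (s : 'S_0) : cyc s = 0%N.
Proof. by apply/eqP; rewrite cards_eq0 -subset0; apply/subsetP=> A /imsetP[[]]. Qed.

Section Up.
Variable d : nat.
Implicit Types s : 'S_d.

Definition up s : 'S_d.+1 := lift_perm ord0 ord0 s.

Lemma up0 s : up s ord0 = ord0. Proof. exact: lift_perm_id. Qed.
Lemma up_lift s x : up s (lift ord0 x) = lift ord0 (s x). Proof. exact: lift_perm_lift. Qed.

Lemma upM s s' : (up (s * s') = up s * up s')%g.
Proof.
by apply/permP=> i; rewrite permM; case: (unliftP ord0 i) => [j ->|->]; rewrite ?up0 ?up_lift ?permM.
Qed.

Lemma upV s : (up s^-1 = (up s)^-1)%g.
Proof. by apply: (mulgI (up s)); rewrite -upM !mulgV; apply/permP=> i; rewrite perm1; case: (unliftP ord0 i) => [j ->|->]; rewrite ?up0 ?up_lift ?perm1. Qed.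

Lemma up_inj : injective up.
Proof. by move=> s s' e; apply/permP=> x; apply: (@lift_inj _ ord0); rewrite -!up_lift e. Qed.

Lemma porbit_up0 s : porbit (up s) ord0 = [set ord0].
Proof.
apply/setP=> y; rewrite inE; apply/porbitP/eqP => [[i ->]|->]; last by exists 0%N; rewrite perm1.
by elim: i => [|i IH]; rewrite ?perm1 // expgSr permM IH up0.
Qed.

Lemma up_pow s i x : (up s ^+ i)%g (lift ord0 x) = lift ord0 ((s ^+ i)%g x).
Proof. by elim: i => [|i IH]; rewrite ?perm1 // !expgSr !permM IH up_lift. Qed.

Lemma porbit_up s x : porbit (up s) (lift ord0 x) = lift ord0 @: porbit s x.
Proof.
apply/setP=> y; apply/porbitP/imsetP => [[i ->]|[z /porbitP[i ->] ->]].
  by exists ((s ^+ i)%g x); rewrite ?up_pow // mem_porbit.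
by exists i; rewrite up_pow.
Qed.

Lemma cyc_up s : cyc (up s) = (cyc s).+1.
Proof.
rewrite /cyc; have -> : porbits (up s) = [set ord0] |: [set lift ord0 @: A | A : {set 'I_d} in porbits s].
  apply/setP=> A; rewrite inE in_set1; apply/imsetP/orP => [[i _ ->]|[/eqP->|/imsetP[B /imsetP[x _ ->] ->]]].
  - case: (unliftP ord0 i) => [x ->|->]; last by left; rewrite porbit_up0.
    by right; rewrite porbit_up; apply/imset_f/imset_f.
  - by exists ord0; rewrite ?porbit_up0.
  - by exists (lift ord0 x); rewrite ?porbit_up.
rewrite cardsU1 card_imset; last exact: imset_inj lift_inj.
case: imsetP => // -[B _ /setP/(_ ord0)]; rewrite inE eqxx => /esym/imsetP[x _ /eqP].
by rewrite (negPf (neq_lift _ _)).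
Qed.

(** The new point stays a cycle of its own if j is [ord0]; otherwise the transposition inserts it
    into the cycle of j. *)
Lemma cyc_up_tperm s j : cyc (up s * tperm ord0 j) = (cyc s + (j == ord0))%N.
Proof.
rewrite -cycV invMg tpermV -upV /cyc.
have [->|j0] := eqVneq j ord0; first by rewrite tperm1 mul1g -/(cyc _) cyc_up cycV addn1.
have := porbits_mul_tperm (up s^-1)%g ord0 j; rewrite /= porbit_sym porbit_up0 inE j0 eq_sym j0.
by rewrite -[#|porbits (up _)|]/(cyc (up s^-1)) cyc_up cycV addn1 addn0 addn2 => -[].
Qed.

Lemma big_up (R : Type) (idx : R) (op : Monoid.com_law idx) (F : 'S_d.+1 -> R) :
  \big[op/idx]_r F r = \big[op/idx]_(s : 'S_d) \big[op/idx]_j F (up s * tperm ord0 j)%g.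
Proof.
rewrite pair_big /= (reindex (fun sj : 'S_d * 'I_d.+1 => (up sj.1 * tperm ord0 sj.2)%g)) //=.
have inj : injective (fun sj : 'S_d * 'I_d.+1 => (up sj.1 * tperm ord0 sj.2)%g).
  move=> [s j] [s' j'] /= e; have /= := congr1 (fun r : 'S_d.+1 => r ord0) e.
  rewrite !permM !up0 !tpermL => ej; rewrite ej in e *.
  by move/mulIg/up_inj: e => ->.
apply: onW_bij; apply: inj_card_bij inj _.
by rewrite card_prod !card_Sn card_ord factS mulnC.
Qed.

(** The point [ord0] is cut out of its cycle; by [downK] the default value is never taken. *)
Definition down (r : 'S_d.+1) : 'S_d := odflt 1%g [pick s | r == up s * tperm ord0 (r ord0)]%g.

Lemma downK r : r = (up (down r) * tperm ord0 (r ord0))%g.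
Proof.
rewrite /down; case: pickP => [s /eqP //|h].
have [s [j e]] : exists s j, r = (up s * tperm ord0 j)%g.
  (* The indicator of r has a positive sum; [big_up] rewrites this sum over the pairs (s, j), so one
     of them produces r. *)
  have : (0 < \sum_(q : 'S_d.+1) (q == r))%N by rewrite (bigD1 r) //= eqxx.
  rewrite big_up lt0n sum_nat_eq0 negb_forall => /existsP[s]; rewrite implyTb sum_nat_eq0 negb_forall.
  by case/existsP=> j; rewrite implyTb eqb0 negbK => /eqP <-; exists s, j.
by have := h s; rewrite {2 3}e permM up0 tpermL -e eqxx.
Qed.

Lemma down_up s j : down (up s * tperm ord0 j) = s.
Proof.
by have := downK (up s * tperm ord0 j)%g; rewrite permM up0 tpermL => /mulIg /up_inj /esym.
Qed.
End Up.

Section Ext.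
Variables (X : finType) (d : nat).

Definition ext (c : X) (g : {ffun 'I_d -> X}) : {ffun 'I_d.+1 -> X} :=
  [ffun i => if unlift ord0 i is Some j then g j else c].

Lemma ext0 c g : ext c g ord0 = c. Proof. by rewrite ffunE unlift_none. Qed.
Lemma ext_lift c g j : ext c g (lift ord0 j) = g j. Proof. by rewrite ffunE liftK. Qed.

Lemma big_ext (R : Type) (idx : R) (op : Monoid.com_law idx) (F : {ffun 'I_d.+1 -> X} -> R) :
  \big[op/idx]_f F f = \big[op/idx]_g \big[op/idx]_c F (ext c g).
Proof.
rewrite pair_big /= (reindex (fun gc : {ffun 'I_d -> X} * X => ext gc.2 gc.1)) //=.
exists (fun f => ([ffun j => f (lift ord0 j)], f ord0)) => [[g c] _|f _] /=.
  by rewrite ext0; congr (_, _); apply/ffunP=> j; rewrite ffunE ext_lift.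
by apply/ffunP=> i; case: (unliftP ord0 i) => [j ->|->]; rewrite ?ext0 ?ext_lift ?ffunE.
Qed.
End Ext.

Section PermSums.
Variables (K : idomainType) (N al : nat).

Definition pair_sum d (x y : K) (pi : 'S_d) : K := \sum_s x ^+ cyc s * y ^+ cyc (s * pi)%g.

(** If s is [up s' * tperm ord0 j], then [s * pi] is [up s' * jump ord0 pi j], and the jump sends
    [ord0] to [pi j]: the point is removed from s and from the product together. *)
Lemma pair_sum_rec d x y (pi : 'S_d.+1) : pair_sum x y pi =
  \sum_j x ^+ (j == ord0) * y ^+ (pi j == ord0) * pair_sum x y (down (jump ord0 pi j)).
Proof.
rewrite /pair_sum big_up exchange_big; apply: eq_bigr => j _ /=.
rewrite mulr_sumr; apply: eq_bigr => s _.
rewrite cyc_up_tperm -mulgA -/(jump ord0 pi j) {1}(downK (jump ord0 pi j)) mulgA -upM cyc_up_tperm.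
by rewrite permM tpermL !exprD mulrACA mulrC.
Qed.

Lemma cinv_ext d (s : 'S_d) j c (g : {ffun 'I_d -> 'I_N}) :
  cinv (ext c g) (up s * tperm ord0 j)%g = cinv g s && (ext c g j == c).
Proof.
apply/cinvP/andP => [h|[/cinvP h /eqP hj] i].
  have hj : ext c g j = c by have := h ord0; rewrite permM up0 tpermL ext0.
  split; last exact/eqP.
  apply/cinvP=> x; have := h (lift ord0 x); rewrite permM up_lift ext_lift => <-.
  case: tpermP => [/eqP|e|_ _]; last by rewrite ext_lift.
    by rewrite eq_sym (negPf (neq_lift _ _)).
  by rewrite ext0 -hj -e ext_lift.
case: (unliftP ord0 i) => [x ->|->]; rewrite permM ?up0 ?up_lift ?tpermL ?ext0 //.
rewrite ext_lift -h; case: tpermP => [/eqP|e|_ _]; last by rewrite ext_lift.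
  by rewrite eq_sym (negPf (neq_lift _ _)).
by rewrite ext0 -hj -e ext_lift.
Qed.

Lemma mon_ext d c (g : {ffun 'I_d -> 'I_N}) : mon K ord0 (ext c g) = \prod_i 'X_(g i).
Proof.
rewrite /mon big_mkcond big_ord_recl /= mul1r; apply: eq_bigr => i _.
by rewrite ext_lift.
Qed.

(** A fixed point [ord0] has a free colour, which gives N; otherwise its colour is that of its
    cycle. *)
Lemma colour_sum_butE d (r : 'S_d.+1) :
  colour_sum_but K N ord0 r = N%:R ^+ (r ord0 == ord0) * colour_sum K N (down r).
Proof.
rewrite {1}(downK r); move: (down r) (r ord0) => s j.
rewrite /colour_sum_but big_mkcond big_ext /colour_sum mulr_sumr [RHS]big_mkcond /=.
apply: eq_bigr => g _.
under eq_bigr => c _ do rewrite cinv_ext mon_ext.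
case: (cinv g s) => /=; last by rewrite big1.
case: (unliftP ord0 j) => [x ->|->].
  rewrite eq_sym (negPf (neq_lift _ _)) mul1r -big_mkcond (big_pred1 (g x)) //= => c.
  by rewrite ext_lift eq_sym.
by under eq_bigr => c _ do rewrite ext0 eqxx; rewrite sumr_const card_ord mulr_natl.
Qed.

Lemma down_jump d (pi : 'S_d.+1) j : pi j = ord0 -> down (jump ord0 pi j) = down pi.
Proof.
move=> hj; rewrite -[RHS](down_up _ ord0) tperm1 mulg1; congr down.
have pE := downK pi; set t := down pi in pE *; rewrite /jump {1}pE mulgA (conjgC (tperm _ _)) tpermJ up0.
have -> : up t j = pi ord0.
  by move: hj; rewrite {1}pE permM; move: (up t j) => y; case: tpermP => // ->.
by rewrite -mulgA tperm2 mulg1.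
Qed.

(** The formula for the moments of products of power sums of complex Wishart eigenvalues. Both sides
    obey the same recursion: [pair_sum_rec] and [colour_tutte]. *)
Theorem pair_sum_laguerre d (pi : 'S_d) :
  pair_sum N%:R (al + N)%:R pi * laguerre al (disc K N) = laguerre al (disc K N * colour_sum K N pi).
Proof.
elim: d pi => [|d IH] pi.
  rewrite /pair_sum (eq_bigr (fun=> 1)) => [|s _]; last by rewrite !cyc_perm0 mulr1.
  rewrite sumr_const card_Sn mul1r /colour_sum (eq_bigr (fun=> 1)) => [|f _]; last by rewrite big_ord0.
  rewrite (eq_bigl predT) => [|f]; last by apply/forallP; case.
  by rewrite sumr_const card_ffun !card_ord mulr1.
rewrite pair_sum_rec (colour_tutte K N al ord0) mulr_suml.
under eq_bigr => j _ do rewrite -mulrA IH -(laguerre_C al).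
rewrite -linear_sum /=; congr (laguerre _ _).
under eq_bigr => j _ do rewrite mulrCA.
rewrite -mulr_sumr; congr (_ * _).
pose CB := colour_sum_but K N (ord0 : 'I_d.+1); pose CS (r : 'S_d.+1) := colour_sum K N (down r).
(* [colour_sum_butE] has N where the recursion has al + N, at the single j with [pi j = ord0]. The
   excess al completes the term j = [ord0], which is N times [CB pi], to the factor al + N. *)
transitivity (\sum_j N%:R ^+ (j == ord0) * CB (jump ord0 pi j)
   + \sum_(j | pi j == ord0) al%:R * (N%:R ^+ (j == ord0) * CS (jump ord0 pi j))).
  rewrite [X in _ + X]big_mkcond -big_split; apply: eq_bigr => j _ /=.
  rewrite /CB colour_sum_butE permM tpermL mpolyCM !rmorphXn !rmorph_nat /CS.
  by case: (pi j == ord0); rewrite ?expr1 ?expr0 ?natrD; ring.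
rewrite (bigD1 ord0) //= expr1 /jump tperm1 mul1g natrD mulrDl.
rewrite (eq_bigr (fun j => CB (jump ord0 pi j))) => [|j j0]; last by rewrite (negPf j0) mul1r.
rewrite [LHS]addrC -[RHS]addrA; congr (_ + _).
rewrite (big_pred1 (pi^-1%g ord0)) => [|j]; last by rewrite -[RHS](inj_eq (@perm_inj _ pi)) permKV.
rewrite -/(jump ord0 pi _) /CS down_jump ?permKV // /CB colour_sum_butE.
by rewrite -(inj_eq (@perm_inj _ pi)) permKV eq_sym.
Qed.
End PermSums.

(** * Cycle weights and powers of linear factors *)

Section Weights.
Variables (K : idomainType) (N : nat) (x : K).
Local Notation P := {mpoly K[N]}.

Definition col_weight d (f : {ffun 'I_d -> 'I_N}) : K := \sum_(s : 'S_d | cinv f s) x ^+ cyc s.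
Definition colour_total d : P := \sum_(s : 'S_d) (x ^+ cyc s) *: colour_sum K N s.

Lemma colour_totalE d : colour_total d = \sum_f col_weight f *: \prod_(i < d) 'X_(f i).
Proof.
rewrite /colour_total; under eq_bigr => s _ do rewrite /colour_sum scaler_sumr.
rewrite (exchange_big_dep predT) //=; apply: eq_bigr => f _.
by rewrite /col_weight scaler_suml.
Qed.

(** The new point either forms its own cycle, of weight x, or is inserted before a point of its
    colour. *)
Lemma col_weight_ext d c (g : {ffun 'I_d -> 'I_N}) :
  col_weight (ext c g) = (x + \sum_j (g j == c)%:R) * col_weight g.
Proof.
rewrite /col_weight big_mkcond big_up mulr_sumr [RHS]big_mkcond; apply: eq_bigr => s _.
under eq_bigr => j _ do rewrite cinv_ext cyc_up_tperm.
case: (cinv g s) => /=; last by rewrite big1.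
rewrite big_ord_recl ext0 !eqxx addn1 exprS mulrDl; congr (_ + _).
rewrite mulr_suml; apply: eq_bigr => j _; rewrite ext_lift addn0.
by case: eqP; rewrite ?mul1r ?mul0r.
Qed.

Lemma mderiv_prodX d (g : {ffun 'I_d -> 'I_N}) a :
  'X_a * (\prod_i 'X_(g i))^`M(a) = (\sum_j (g j == a)%:R)%:MP * \prod_i 'X_(g i) :> P.
Proof.
rewrite mderiv_prod ?index_enum_uniq // mulr_sumr rmorph_sum mulr_suml; apply: eq_bigr => j _.
rewrite rmorph_nat mderiv_Xi; case: eqP => [<-|_]; last by rewrite !(mul0r, mulr0).
by rewrite !mul1r [in RHS](bigD1 j).
Qed.

Lemma colour_total_rec d : colour_total d.+1 =
  \sum_a 'X_a * (x%:MP * colour_total d + 'X_a * (colour_total d)^`M(a)).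
Proof.
rewrite !colour_totalE big_ext exchange_big; apply: eq_bigr => a _ /=.
rewrite linear_sum !mulr_sumr -big_split mulr_sumr; apply: eq_bigr => g _ /=.
rewrite col_weight_ext big_ord_recl ext0 -!mul_mpolyC mpolyCM.
have -> : \prod_(i < d) 'X_(ext a g (lift ord0 i)) = \prod_(i < d) 'X_(g i) :> P.
  by apply: eq_bigr => i _; rewrite ext_lift.
rewrite mderiv_mulC [X in _ = _ * (_ + X)]mulrCA mderiv_prodX mpolyCD; ring.
Qed.

Lemma mcoeff_XU a (p : P) m : ('X_a * p)@_m = if m a == 0%N then 0 else p@_(m - U_(a)).
Proof.
case: eqP => [m0|/eqP m0]; last first.
  have e : m = (U_(a) + (m - U_(a)))%MM.
    rewrite addmC submK //; apply/mnm_lepP => l; rewrite mnm1E.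
    by case: eqP => // <-; rewrite lt0n.
  by rewrite {1}e mulrC mcoeffMX.
rewrite mcoeffM big1 // => -[k1 k2] /= /eqP e; rewrite mcoeffX.
case: eqP => [ek|]; rewrite ?mul0r //.
by have := congr1 (fun m' : 'X_{1..N} => m' a) e; rewrite m0 mnmDE -ek mnm1E eqxx.
Qed.

Lemma mcoeff_euler a (p : P) m : ('X_a * p^`M(a))@_m = (m a)%:R * p@_m.
Proof.
rewrite mcoeff_XU; case: eqP => [->|/eqP m0]; first by rewrite mul0r.
rewrite mcoeff_deriv submK; last first.
  by apply/mnm_lepP => l; rewrite mnm1E; case: eqP => // <-; rewrite lt0n.
by rewrite mnmBE mnm1E eqxx subn1 prednK ?lt0n // mulr_natl.
Qed.

Variable b : nat -> K.
Hypotheses (b0 : b 0 = 1) (bS : forall j, (j.+1)%:R * b j.+1 = (x + j%:R) * b j).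

(** [b j] is the coefficient of X^j in (1 - X)^(-x), so [colour_total d] is d! times the part of
    degree d of the product of the (1 - X_a)^(-x). *)
Lemma mcoeff_colour_total d m :
  (colour_total d)@_m = (mdeg m == d)%:R * d`!%:R * \prod_i b (m i).
Proof.
elim: d m => [|d IH] m.
  have -> : colour_total 0 = 1.
    rewrite colour_totalE [LHS](eq_bigr (fun=> 1)) => [|f _].
      by rewrite sumr_const card_ffun !card_ord.
    rewrite big_ord0 /col_weight [X in X *: _](eq_bigr (fun=> 1)) => [|s _].
      rewrite (eq_bigl predT) => [|s]; last by apply/forallP; case.
      by rewrite sumr_const card_Sn scale1r.
    by rewrite cyc_perm0.
  rewrite mcoeff1 mdeg_eq0 mulr1; case: eqP => [->|]; rewrite ?mul0r // mul1r big1 // => i _.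
  by rewrite mnm0E.
rewrite colour_total_rec linear_sum /=.
transitivity (\sum_a (mdeg m == d.+1)%:R * d`!%:R * \prod_i b (m i) * (m a)%:R).
  apply: eq_bigr => a _; rewrite mcoeff_XU; case: eqP => [->|/eqP m0]; first by rewrite mulr0.
  have mE : (U_(a) <= m)%MM.
    by apply/mnm_lepP => l; rewrite mnm1E; case: eqP => // <-; rewrite lt0n.
  rewrite mcoeffD mcoeffCM mcoeff_euler -mulrDl IH mnmBE mnm1E eqxx.
  have -> : (mdeg (m - U_(a)) == d) = (mdeg m == d.+1).
    by rewrite -{2}(submK mE) mdegD mdeg1 addn1.
  rewrite (bigD1 a) //= [in RHS](bigD1 a) //= mnmBE mnm1E eqxx subn1.
  have -> : \prod_(i | i != a) b ((m - U_(a))%MM i) = \prod_(i | i != a) b (m i).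
    by apply: eq_bigr => i ia; rewrite mnmBE mnm1E eq_sym (negPf ia) subn0.
  have := bS (m a).-1; rewrite prednK ?lt0n // => h.
  transitivity ((mdeg m == d.+1)%:R * d`!%:R * ((x + (m a).-1%:R) * b (m a).-1) * \prod_(i | i != a) b (m i)); first by ring.
  by rewrite -h; ring.
rewrite -mulr_sumr -natr_sum -mdegE factS natrM; case: eqP => [->|]; rewrite ?mul0r //.
by ring.
Qed.
End Weights.

(** * From the Laguerre mean to a Hankel determinant *)

Section DiscVdm.
Variables (K : idomainType) (N : nat).

Definition vdm : 'M[{mpoly K[N]}]_N := Vandermonde N (\row_i 'X_i).
Definition disc_sign : K := \prod_(i < N) \prod_(j < N | (i < j)%N) -1.

Lemma disc_sign_neq0 : disc_sign != 0.
Proof. by apply/prodf_neq0 => i _; apply/prodf_neq0 => j _; rewrite oppr_eq0 oner_neq0. Qed.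

Lemma disc_vdm : disc K N = disc_sign%:MP * (\det vdm * \det vdm).
Proof.
rewrite /vdm det_Vandermonde mulrA.
have -> : disc K N = \prod_i \prod_(j | i != j) ('X_i - 'X_j).
  rewrite /disc big_mkcond -(pair_bigA _ (fun i j => if i != j then 'X_i - 'X_j else 1)).
  by apply: eq_bigr => i _; rewrite -big_mkcond.
have -> : \prod_(i < N) \prod_(j < N | i != j) ('X_i - 'X_j) =
   (\prod_(i < N) \prod_(j < N | (i < j)%N) ('X_i - 'X_j)) *
   (\prod_(i < N) \prod_(j < N | (j < i)%N) ('X_i - 'X_j)) :> {mpoly K[N]}.
  rewrite -big_split; apply: eq_bigr => i _ /=.
  rewrite (bigID (fun j : 'I_N => (i < j)%N)) /=; congr (_ * _); apply: eq_bigl => j.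
    by rewrite -val_eqE /=; case: ltngtP.
  by rewrite -val_eqE /=; case: ltngtP.
congr (_ * _).
  rewrite /disc_sign rmorph_prod -big_split; apply: eq_bigr => i _ /=.
  rewrite rmorph_prod -big_split; apply: eq_bigr => j _ /=.
  by rewrite !mxE rmorphN rmorph1; ring.
rewrite (exchange_big_dep xpredT) //=; apply: eq_bigr => i _; apply: eq_bigr => j _.
by rewrite !mxE.
Qed.
End DiscVdm.

Section LaguerreSum.
Variables (N al M : nat).
Local Notation K := {poly rat}.
Local Notation P := {mpoly K[N]}.

Definition bcoef j : K := (-1) ^+ j * ('C(M, j))%:R.

Lemma bcoef0 : bcoef 0 = 1. Proof. by rewrite /bcoef bin0 mulr1. Qed.
Lemma bcoef_gt j : (M < j)%N -> bcoef j = 0. Proof. by move=> h; rewrite /bcoef bin_small // mulr0. Qed.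

Lemma bcoefS j : (j.+1)%:R * bcoef j.+1 = (- M%:R + j%:R) * bcoef j.
Proof.
have h : (j.+1)%:R * ('C(M, j.+1))%:R = (M%:R - j%:R) * ('C(M, j))%:R :> K.
  case: (leqP j M) => jM; last by rewrite !bin_small ?mulr0 ?mul0r // ltnW.
  by rewrite -natrM mul_bin_left natrM natrB.
by rewrite /bcoef mulrCA h exprS; ring.
Qed.

(* The product of the (1 - s x_a)^M, where s is the variable of K. *)
Definition phi : P := \prod_(a < N) \sum_(j < M.+1) (bcoef j * 'X^j) *: 'X_a ^+ j.

Lemma mcoeff_phi m : phi@_m = \prod_i (bcoef (m i) * 'X^(m i)).
Proof.
rewrite /phi bigA_distr_bigA linear_sum /=.
transitivity (\sum_(f : {ffun 'I_N -> 'I_M.+1})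
    \prod_i (bcoef (f i) * 'X^(f i)) * ([multinom (f i : nat) | i < N] == m)%:R).
  apply: eq_bigr => f _; rewrite scaler_prod mcoeffZ; congr (_ * _).
  rewrite -mcoeffX mpolyXE_id; congr (mcoeff _ _); apply: eq_bigr => i _.
  by rewrite mnmE.
have [hm|/forallPn[i hi]] := boolP [forall i, (m i < M.+1)%N]; last first.
  rewrite [RHS](bigD1 i) //= bcoef_gt ?mul0r ?mul0r; last by rewrite ltnNge.
  apply: big1 => f _; case: eqP => [e|]; rewrite ?mulr0 //.
  by move: hi; rewrite -e mnmE ltn_ord.
pose f0 : {ffun 'I_N -> 'I_M.+1} := [ffun i => inord (m i)].
have f0E i : f0 i = m i :> nat by rewrite ffunE inordK //; apply/forallP: i.
rewrite (bigD1 f0) //= [X in _ + X]big1 => [|f ff0].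
  rewrite addr0 (_ : _ == m) ?mulr1; first by apply: eq_bigr => i _; rewrite f0E.
  by apply/eqP/mnmP=> i; rewrite mnmE f0E.
case: eqP => [e|]; rewrite ?mulr0 //; case/eqP: ff0; apply/ffunP=> i; apply: val_inj => /=.
by rewrite f0E -e mnmE.
Qed.

(** [phi] has degree at most N M in the X_a, so the truncation at n loses nothing. *)
Lemma phiE n : (N * M < n)%N -> phi = \sum_(d < n) ((d`!%:R^-1)%:P * 'X^d) *: colour_total N (- M%:R) d.
Proof.
move=> hn; apply/mpolyP=> m; rewrite mcoeff_phi linear_sum /=.
under [RHS]eq_bigr => d _ do rewrite mcoeffZ (mcoeff_colour_total bcoef0 bcoefS).
rewrite big_split /= prodrXr -mdegE.
have [lm|] := ltnP (mdeg m) n.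
  rewrite [RHS](bigD1 (Ordinal lm)) //= eqxx [X in _ + X]big1 => [|d dm]; last first.
    by rewrite eq_sym (_ : (d : nat) == _ = false) ?mul0r ?mulr0 //; apply: negbTE.
  have f1 : ((mdeg m)`!%:R^-1)%:P * (mdeg m)`!%:R = 1 :> K.
    by rewrite -polyC_natr -polyCM mulVf // pnatr_eq0 -lt0n fact_gt0.
  rewrite addr0 mul1r; set B := \prod_(i < N) _.
  by transitivity (((mdeg m)`!%:R^-1)%:P * (mdeg m)`!%:R * (B * 'X^(mdeg m))); [rewrite f1 mul1r | ring].
move=> nm; rewrite [RHS]big1 => [|d _]; last first.
  rewrite (_ : mdeg m == d = false) ?mul0r ?mulr0 //; apply/negbTE; rewrite neq_ltn.
  by rewrite (leq_trans (ltn_ord d) nm) orbT.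
have [i hi] : exists i, (M < m i)%N.
  apply/existsP; rewrite -[X in is_true X]negbK negb_exists; apply/negP => /forallP h.
  have : (mdeg m <= N * M)%N.
    have -> : (N * M = \sum_(i < N) M)%N by rewrite sum_nat_const card_ord.
    rewrite mdegE; apply: leq_sum => i _.
    by rewrite leqNgt.
  by rewrite leqNgt (leq_trans hn nm).
by rewrite (bigD1 i) //= bcoef_gt // mul0r mul0r.
Qed.

Lemma rising_polyC k : rising K al k = (rising rat al k)%:P.
Proof. by rewrite /rising rmorph_prod; apply: eq_bigr => i _; rewrite rmorph_nat. Qed.

Lemma moment_sum k : moment al M k = \sum_(j < M.+1) bcoef j * 'X^j * rising K al (k + j).
Proof.
rewrite /moment poly_def; apply: eq_bigr => j _; rewrite rising_polyC -mul_polyC !polyCM.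
by rewrite rmorphXn rmorphN rmorph1 polyC_natr /bcoef; ring.
Qed.

(** Heine's formula: expand both Vandermonde determinants. For each permutation s from the first,
    the second yields the moment matrix with rows permuted by s, and the signs cancel; hence N!
    equal terms. *)
Lemma laguerre_disc_phi : laguerre al (disc K N * phi) = disc_sign K N * (N`!)%:R * hdet al M N.
Proof.
rewrite disc_vdm -mulrA laguerre_C -mulrA; congr (_ * _).
pose C := \matrix_(i < N, j < N) moment al M (i + j).
have vE : \det (vdm K N) = \sum_(s : 'S_N) (-1) ^+ s *: \prod_i 'X_i ^+ (s i).
  rewrite -det_tr; apply: eq_bigr => s _; rewrite -mul_mpolyC rmorphXn rmorphN rmorph1; congr (_ * _).
  by apply: eq_bigr => i _; rewrite !mxE.
have eL (p : P) : p * \det (vdm K N) * phi = \sum_(r : 'S_N) (-1) ^+ r *: (p * \prod_i 'X_i ^+ (r i) * phi).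
  by rewrite vE mulr_sumr mulr_suml; apply: eq_bigr => r _; rewrite -scalerAr -scalerAl.
rewrite {1}vE !mulr_suml linear_sum mulr_natl -card_Sn -sumr_const; apply: eq_bigr => /= s _.
rewrite -!scalerAl linearZ /= eL linear_sum /= mulr_sumr.
transitivity ((-1) ^+ s * \det (row_perm s C)); last first.
  by rewrite row_permE det_mulmx det_perm mulrA -expr2 sqrr_sign mul1r.
rewrite /determinant mulr_sumr; apply: eq_bigr => r _; congr (_ * _).
rewrite linearZ /=; congr (_ * _).
rewrite -big_split /= /phi -big_split /=.
transitivity (\prod_i \sum_(j < M.+1) (bcoef j * 'X^j) * rising K al ((s i + r i) + j)).
  rewrite -(laguerre_prod al M.+1 (fun j => bcoef j * 'X^j) (fun i : 'I_N => s i + r i)%N); congr (laguerre _ _); apply: eq_bigr => i _; rewrite mulr_sumr; apply: eq_bigr => j _.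
  by rewrite -scalerAr -!exprD.
by apply: eq_bigr => i _; rewrite !mxE moment_sum.
Qed.
End LaguerreSum.

Definition triple_sum (R : comNzRingType) d (x y z : R) : R :=
  \sum_(p : 'S_d) \sum_(s : 'S_d) x ^+ cyc p * (y ^+ cyc s * z ^+ cyc (s * p)%g).

Definition genZ n (x y z : rat) : {poly rat} :=
  \poly_(d < n) (triple_sum d x y z / d`!%:R).

Lemma phi0 N : phi N 0 = 1.
Proof. by rewrite /phi big1 // => a _; rewrite big_ord1 bcoef0 expr0 mulr1 scale1r. Qed.

(** For M = 0 the product [phi] is 1, so [hdet al 0 N] is the total mass that normalizes the
    mean. *)
Lemma genZ_hdet N al M n : (N * M < n)%N ->
  genZ n (- M%:R) N%:R (al + N)%:R * hdet al 0 N = hdet al M N.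
Proof.
move=> hn; have e0 : disc_sign {poly rat} N * (N`!)%:R != 0.
  by rewrite mulf_neq0 ?disc_sign_neq0 // -polyC_natr polyC_eq0 pnatr_eq0 -lt0n fact_gt0.
have eL : disc {poly rat} N * phi N M = \sum_(d < n) ((d`!%:R^-1)%:P * 'X^d) *:
    \sum_(p : 'S_d) (- M%:R) ^+ cyc p *: (disc {poly rat} N * colour_sum {poly rat} N p).
  rewrite (phiE hn) mulr_sumr; apply: eq_bigr => d _; rewrite -scalerAr; congr (_ *: _).
  by rewrite mulr_sumr; apply: eq_bigr => p _; rewrite -scalerAr.
apply: (mulfI e0); rewrite mulrCA -!laguerre_disc_phi phi0 mulr1 eL linear_sum /=.
rewrite /genZ poly_def big_distrl; apply: eq_bigr => d _ /=.
rewrite linearZ linear_sum /=.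
rewrite -mul_polyC polyCM -!mulrA; set f := _%:P; set g := (_^-1)%:P.
have -> : f = triple_sum d (- M%:R) N%:R (al + N)%:R.
  rewrite /f /triple_sum !rmorph_sum; apply: eq_bigr => p _; rewrite rmorph_sum; apply: eq_bigr => s _.
  by rewrite !rmorphM !rmorphXn rmorphN !rmorph_nat.
rewrite mulrCA; congr (_ * _); rewrite mulrCA; congr (_ * _).
rewrite /triple_sum big_distrl; apply: eq_bigr => p _ /=.
by rewrite linearZ /= -pair_sum_laguerre mulrA; congr (_ * _); rewrite /pair_sum mulr_sumr.
Qed.

Lemma bilin_scale (c : rat) (t u v z : {poly rat}) :
  bilin (@euler rat) 'X t u v (c%:P * z) = (c ^+ 2)%:P * bilin (@euler rat) 'X t u v z.
Proof.
have e (w : {poly rat}) : euler (c%:P * w) = c%:P * euler w.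
  by rewrite /euler derivM derivC mul0r add0r mulrCA.
by rewrite /bilin !e rmorphXn; ring.
Qed.

(** [bilin] is quadratic in z, so the nonzero constant [hdet al 0 N] can be divided out. *)
Theorem genZ_bilin N al M n : (N * M < n)%N ->
  bilin (@euler rat) 'X (- M%:R) N%:R (N + al)%:R (genZ n (- M%:R) N%:R (N + al)%:R) = 0.
Proof.
move=> hn; have := hdet_bilin al M N; rewrite -(genZ_hdet al hn) [(al + N)%N]addnC.
have -> : hdet al 0 N = ((hdet al 0 N)`_0)%:P.
  apply/polyP=> -[|i]; rewrite coefC //=.
  have -> : hdet al 0 N = (detn N (fun i j => rising rat al (i + j)))%:P.
    rewrite (detn_map (polyC : {rmorphism rat -> {poly rat}})); apply: eq_detn => a b _ _.
    by rewrite moment_sum big_ord1 addn0 rising_polyC bcoef0 expr0 !mul1r.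
  by rewrite coefC.
rewrite mulrC bilin_scale => /eqP; rewrite mulf_eq0 polyC_eq0 expf_eq0 /=.
by rewrite (negPf (hdet_coef0 _ _ _)) => /eqP.
Qed.

(** * Connected pairs and dessins *)

Section Log.
Variables (x y z : rat) (f Z : nat -> rat) (n : nat).
Hypotheses (f0 : f 0 = 0) (Z0 : Z 0 = 1).
Hypothesis logZ : forall d, d%:R * Z d = \sum_(k < d.+1) f k * Z (d - k)%N.
Let P := \poly_(d < n) Z d.
Let R := \poly_(d < n) f d.
Let t := x%:P. Let u := y%:P. Let v := z%:P.
Let c := t + u + v.
Let th := @euler rat.

(* R is the logarithmic derivative of P only modulo s^n. *)
Let ode := 2%:R * 'X * t * u * v + c * 'X * (2%:R * th R + R)
    + 'X^2 * ((4%:R * (t * u + t * v + u * v) - c ^+ 2) * th R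
      + th (th (th R)) + 2%:R * th (th R) + th R + 4%:R * R * th R + 6%:R * th R ^+ 2) - (th R + R).

Let euler_Xn_mul (g : {poly rat}) : th ('X^n * g) = 'X^n * (n%:R * g + th g).
Proof.
have h : derivation th := euler_derivation rat.
have eX : th 'X = 'X by rewrite /th /euler derivX mulr1.
rewrite (derM h) (derX h) eX.
by case: n => [|k] /=; rewrite ?exprS; ring.
Qed.

Let log_mod : exists g, th P = R * P + 'X^n * g.
Proof.
exists (drop_poly n (th P - R * P)); apply/polyP=> i.
rewrite coefD coefXnM coef_drop_poly coefB; case: ltnP => [lt_in|le_ni].
  rewrite addr0 coef_euler coefM coef_poly lt_in logZ; apply: eq_bigr => k _.
  have ki : (k <= i)%N by rewrite -ltnS.
  by rewrite !coef_poly (leq_ltn_trans ki lt_in) (leq_ltn_trans (leq_subr _ _) lt_in).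
by rewrite subnK // addrC subrK.
Qed.

Lemma bilin_ode : bilin th 'X t u v P = 0 -> exists g, ode * P ^+ 2 = 'X^n * g.
Proof.
have [g e1] := log_mod; have h : derivation th := euler_derivation rat.
have [g2 e2] : exists q, th (th P) = (th R + R ^+ 2) * P + 'X^n * q.
  exists (R * g + (n%:R * g + th g)).
  by rewrite e1 (derD h) (derM h) euler_Xn_mul e1; ring.
have [g3 e3] : exists q, th (th (th P)) =
    (th (th R) + 3%:R * R * th R + R ^+ 3) * P + 'X^n * q.
  exists ((th R + R ^+ 2) * g + (n%:R * g2 + th g2)).
  by rewrite e2 (derD h) euler_Xn_mul (derM h) (derD h) (derX h) e1; ring.
have dR3 : th (R ^+ 3) = 3%:R * R ^+ 2 * th R by rewrite (derX h).
have dRR : th (3%:R * R * th R) = 3%:R * (th R ^+ 2 + R * th (th R)).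
  by rewrite -mulrA (der_natMl h) (derM h) -expr2.
have [g4 e4] : exists q, th (th (th (th P))) = (th (th (th R)) + 4%:R * R * th (th R)
    + 3%:R * th R ^+ 2 + 6%:R * R ^+ 2 * th R + R ^+ 4) * P + 'X^n * q.
  exists ((th (th R) + 3%:R * R * th R + R ^+ 3) * g + (n%:R * g3 + th g3)).
  by rewrite e3 (derD h) euler_Xn_mul (derM h) !(derD h) dR3 dRR e1; ring.
pose w1 := R * P; pose w2 := (th R + R ^+ 2) * P.
pose w3 := (th (th R) + 3%:R * R * th R + R ^+ 3) * P.
rewrite /bilin e4 e3 e2 e1 -/c.
set bb := 4%:R * _ - _ => hB.
(* The witness collects the terms of [bilin] that contain a remainder g, g2, g3 or g4; a product of
   two remainders keeps one more power of s^n. *)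
exists (- (c * 'X * (2%:R * (g2 * P - 2%:R * w1 * g - 'X^n * g ^+ 2) + g * P)
  + 'X^2 * (bb * (g2 * P - 2%:R * w1 * g - 'X^n * g ^+ 2)
     + g4 * P - 4%:R * (w1 * g3 + g * w3 + 'X^n * g * g3) + 3%:R * (2%:R * w2 * g2 + 'X^n * g2 ^+ 2)
     + 2%:R * g3 * P - 2%:R * (w1 * g2 + g * w2 + 'X^n * g * g2)
     + g2 * P - 2%:R * w1 * g - 'X^n * g ^+ 2)
  - (g2 * P - 2%:R * w1 * g - 'X^n * g ^+ 2 + g * P))).
rewrite -[RHS]addr0 -hB /ode -/bb /w1 /w2 /w3; ring.
Qed.

(** P^2 has constant term 1, hence is invertible modulo s^n. *)
Lemma ode_coef d : bilin th 'X t u v P = 0 -> (d < n)%N -> ode`_d = 0.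
Proof.
move=> /bilin_ode[g e]; elim/ltn_ind: d => d IH dn.
have := congr1 (fun q : {poly rat} => q`_d) e; rewrite /= coefXnM dn coefM big_ord_recr /= subnn.
have -> : (P ^+ 2)`_0 = 1 by rewrite expr2 coef0M !coef_poly (leq_ltn_trans _ dn) // Z0 mulr1.
rewrite mulr1 big1 ?add0r // => i _.
by rewrite IH ?mul0r // (ltn_trans _ dn).
Qed.

Lemma log_rec (a := x + y + z) (b := 4%:R * (x * y + x * z + y * z) - a ^+ 2) d :
  bilin th 'X t u v P = 0 -> (2 <= d < n)%N ->
  (d + 1)%:R * f d = (2 * d - 1)%:R * a * f (d - 1)%N + (d - 2)%:R * b * f (d - 2)%N
    + ((d - 1) ^ 2 * (d - 2))%:R * f (d - 2)%N
    + \sum_(1 <= j < d - 2) ((4 + 6 * j) * (d - 2 - j))%:R * f j * f (d - 2 - j)%N.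
Proof.
move=> hB /andP[]; case: d => [|[|d]] // _ dn; have := ode_coef hB dn.
have cE : c = a%:P by rewrite /c /a !polyCD.
have bE : 4%:R * (t * u + t * v + u * v) - c ^+ 2 = b%:P.
  by rewrite cE /b !(rmorphB, rmorphM, rmorphD, rmorphXn, rmorph_nat).
have RE i : (i < n)%N -> R`_i = f i by rewrite coef_poly => ->.
have dn1 : (d.+1 < n)%N by rewrite ltnW.
have dn0 : (d < n)%N by rewrite ltnW.
have -> : ode = 'X * ((2%:R * x * y * z)%:P + a%:P * (2%:R * th R + R)) +
    'X^2 * (b%:P * th R + (th (th (th R)) + 2%:R * th (th R) + th R)
      + (4%:R * R + 6%:R * th R) * th R) - (th R + R).
  by rewrite /ode bE cE !(rmorphM, rmorph_nat); ring.
have -> : (2 * d.+2 - 1)%:R = 2%:R * (d.+1)%:R + 1 :> rat.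
  by rewrite -natrM natr1; congr (_%:R); lia.
rewrite coefB !coefD coefXM coefXnM /= coefD coefC /= !subSS !subn0 !coefD coefCM [in X in _ + X - _]coefM.
rewrite !coefCM !coefD -!(polyC_natr _ 2) !coefCM !coef_euler !RE //.
rewrite add0r => /eqP; rewrite subr_eq0 => /eqP e.
transitivity ((d.+2)%:R * f d.+2 + f d.+2); first by rewrite addn1 -natr1 mulrDl mul1r.
rewrite -e (eq_bigr (fun j : 'I_d.+1 => ((4 + 6 * j) * (d - j))%:R * f j * f (d - j)%N)); last first.
  move=> j _; have jn : (j < n)%N by rewrite (leq_ltn_trans _ dn0) // -ltnS.
  rewrite coefD -(polyC_natr _ 4) -(polyC_natr _ 6) !coefCM !coef_euler !RE ?(leq_ltn_trans (leq_subr _ _) dn0) //.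
  by rewrite natrM natrD natrM; ring.
(* The end terms of the convolution vanish: [f 0 = 0] at j = 0, and the factor d - j at j = d. *)
rewrite -(big_mkord xpredT (fun j => ((4 + 6 * j) * (d - j))%:R * f j * f (d - j)%N)) big_ltn // f0.
rewrite mulr0 mul0r add0r; have -> : \sum_(1 <= j < d.+1) ((4 + 6 * j) * (d - j))%:R * f j * f (d - j)%N
   = \sum_(1 <= j < d) ((4 + 6 * j) * (d - j))%:R * f j * f (d - j)%N.
  case: (d) => [|k]; first by rewrite !big_geq.
  by rewrite big_nat_recr //= subnn muln0 !mul0r addr0.
rewrite natrM natrX -[(d.+1)%:R]natr1; ring.
Qed.
End Log.

(** * Splitting off the joint orbit of a point *)

Section Orbits.
Variable T : finType.
Implicit Types (p s : {perm T}) (B : {set T}) (x : T).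

Definition stable p s B := [forall y in B, (p y \in B) && (s y \in B)].
Definition joint_orbit p s x := orbit 'P <<[set s; p]>>%g x.
Definition joint_trans p s := [transitive <<[set s; p]>>%g, on [set: T] | 'P].

Lemma stableP p s B : reflect (forall y, y \in B -> p y \in B /\ s y \in B) (stable p s B).
Proof. by apply: (iffP forall_inP) => h y /h => [/andP|[-> ->]]. Qed.

Lemma perm_stable_in p B : (forall y, y \in B -> p y \in B) -> forall y, (p y \in B) = (y \in B).
Proof.
move=> h y; have e : p @: B = B.
  apply/eqP; rewrite eqEcard card_imset ?leqnn ?andbT; last exact: perm_inj.
  by apply/subsetP=> _ /imsetP[z zB ->]; apply: h.
by rewrite -{1}e mem_imset //; exact: perm_inj.
Qed.

Lemma joint_orbit_min p s B x : x \in B -> stable p s B -> joint_orbit p s x \subset B.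
Proof.
move=> xB /stableP hB; apply/subsetP=> y /orbitP[g gG <-].
suff : g \in ('N(B | 'P))%g by move/astabs_act ->.
move: gG; apply/subsetP; rewrite gen_subG; apply/subsetP=> q; rewrite !inE.
by case/orP=> /eqP ->; rewrite ?inE; apply/subsetP=> z zB; rewrite inE /= apermE; case: (hB z zB).
Qed.

Lemma joint_orbit_refl p s x : x \in joint_orbit p s x.
Proof. exact: orbit_refl. Qed.

Lemma joint_orbit_stable p s x : stable p s (joint_orbit p s x).
Proof.
apply/stableP=> y hy; rewrite -!apermE; split.
  by rewrite orbit_actr // mem_gen // !inE eqxx orbT.
by rewrite orbit_actr // mem_gen // !inE eqxx.
Qed.

Lemma joint_transP p s x :
  reflect (forall B, x \in B -> stable p s B -> B = [set: T]) (joint_trans p s).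
Proof.
apply: (iffP idP) => [/atransP/(_ x (in_setT x)) h B xB hB|h].
  by apply/eqP; rewrite -subTset -h; apply: joint_orbit_min.
apply/imsetP; exists x; rewrite ?inE //; apply/esym/h; first exact: joint_orbit_refl.
exact: joint_orbit_stable.
Qed.
End Orbits.

Section Glue.
Variables (A B T : finType) (H : A + B -> T) (H' : T -> A + B).
Hypotheses (HK : cancel H H') (H'K : cancel H' H).
Implicit Types (q r : {perm A}) (k l : {perm B}).

Definition smap q k (z : A + B) := match z with inl a => inl (q a) | inr b => inr (k b) end.

Lemma glue_inj q k : injective (fun x => H (smap q k (H' x))).
Proof.
move=> x y /(can_inj HK) e; apply: (can_inj H'K); case: (H' x) (H' y) e => [a|b] [a'|b'] //= [].
  by move/perm_inj ->.
by move/perm_inj ->.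
Qed.

Definition glue q k : {perm T} := perm (@glue_inj q k).

Lemma glueE q k z : glue q k (H z) = H (smap q k z).
Proof. by rewrite permE HK. Qed.

Lemma glue_ext (p p' : {perm T}) : (forall z, p (H z) = p' (H z)) -> p = p' :> {perm T}.
Proof. by move=> h; apply/permP=> x; rewrite -(H'K x) h. Qed.

Lemma glueM q r k l : glue (q * r) (k * l) = (glue q k * glue r l)%g.
Proof. by apply: glue_ext => -[a|b]; rewrite permM !glueE /= permM. Qed.

Lemma glue_injl q r k l : glue q k = glue r l -> q = r /\ k = l.
Proof.
move=> e; split; apply/permP=> i.
  by have := congr1 (fun p : {perm T} => p (H (inl i))) e; rewrite /= !glueE => /(can_inj HK) [].
by have := congr1 (fun p : {perm T} => p (H (inr i))) e; rewrite /= !glueE => /(can_inj HK) [].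
Qed.

Lemma glue_powl q k i a : (glue q k ^+ i)%g (H (inl a)) = H (inl ((q ^+ i)%g a)).
Proof. by elim: i => [|i IH]; rewrite ?perm1 // !expgSr !permM IH glueE. Qed.

Lemma glue_powr q k i b : (glue q k ^+ i)%g (H (inr b)) = H (inr ((k ^+ i)%g b)).
Proof. by elim: i => [|i IH]; rewrite ?perm1 // !expgSr !permM IH glueE. Qed.

Let hl a := H (inl a). Let hr b := H (inr b).
Let hl_inj : injective hl. Proof. by move=> a b /(can_inj HK) []. Qed.
Let hr_inj : injective hr. Proof. by move=> a b /(can_inj HK) []. Qed.

Lemma porbit_gluel q k a : porbit (glue q k) (H (inl a)) = hl @: porbit q a.
Proof.
apply/setP=> y; apply/porbitP/imsetP => [[i ->]|[z /porbitP[i ->] ->]].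
  by exists ((q ^+ i)%g a); rewrite ?glue_powl // mem_porbit.
by exists i; rewrite glue_powl.
Qed.

Lemma porbit_gluer q k b : porbit (glue q k) (H (inr b)) = hr @: porbit k b.
Proof.
apply/setP=> y; apply/porbitP/imsetP => [[i ->]|[z /porbitP[i ->] ->]].
  by exists ((k ^+ i)%g b); rewrite ?glue_powr // mem_porbit.
by exists i; rewrite glue_powr.
Qed.

Lemma cyc_glue q k : cyc (glue q k) = (cyc q + cyc k)%N.
Proof.
rewrite /cyc; pose X := [set hl @: P | P : {set A} in porbits q].
pose Y := [set hr @: P | P : {set B} in porbits k].
have -> : porbits (glue q k) = X :|: Y.
  apply/setP=> P; rewrite inE; apply/imsetP/orP.
    case=> x _ ->; rewrite -(H'K x); case: (H' x) => [a|b]; [left|right].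
      by rewrite porbit_gluel; apply/imset_f/imset_f.
    by rewrite porbit_gluer; apply/imset_f/imset_f.
  case=> /imsetP[_ /imsetP[a _ ->] ->]; last by exists (hr a); rewrite ?porbit_gluer.
  by exists (hl a); rewrite ?porbit_gluel.
have XY : X :&: Y = set0.
  apply/setP=> P; rewrite !inE; apply/negP => /andP[/imsetP[_ /imsetP[a _ ->] ->]].
  case/imsetP=> Q _ /setP/(_ (hl a)); rewrite mem_imset // porbit_id => /esym/imsetP[b _].
  by move/(can_inj HK).
by rewrite cardsU XY cards0 subn0 (card_imset _ (imset_inj hl_inj)) (card_imset _ (imset_inj hr_inj)).
Qed.

Let O := [set hl a | a : A].
Let in_O a : H (inl a) \in O. Proof. exact: imset_f. Qed.
Let notin_O b : H (inr b) \in O = false.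
Proof. by apply/negP => /imsetP[a _ /(can_inj HK)]. Qed.

Lemma glue_surj (p : {perm T}) : (forall y, y \in O -> p y \in O) ->
  exists q k, p = glue q k.
Proof.
move=> /perm_stable_in hp.
pose f a := if H' (p (H (inl a))) is inl a' then a' else a.
pose g b := if H' (p (H (inr b))) is inr b' then b' else b.
have fE a : H (inl (f a)) = p (H (inl a)).
  have := hp (H (inl a)); rewrite in_O /f -[p _]H'K HK; case: (H' _) => // b.
  by rewrite notin_O.
have gE b : H (inr (g b)) = p (H (inr b)).
  have := hp (H (inr b)); rewrite notin_O /g -[p _]H'K HK; case: (H' _) => // a.
  by rewrite in_O.
have fi : injective f by move=> a b e; have := fE a; rewrite e fE => /perm_inj /hl_inj.
have gi : injective g by move=> a b e; have := gE a; rewrite e gE => /perm_inj /hr_inj.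
by exists (perm fi), (perm gi); apply: glue_ext => -[a|b]; rewrite glueE /= permE.
Qed.

Lemma joint_orbit_glue q r k l a :
  (joint_orbit (glue q k) (glue r l) (H (inl a)) == O) = joint_trans q r.
Proof.
set J := joint_orbit _ _ _.
have /stableP hJ : stable (glue q k) (glue r l) J by exact: joint_orbit_stable.
have JO : J \subset O.
  apply: joint_orbit_min; first exact: in_O.
  by apply/stableP=> _ /imsetP[b _ ->]; rewrite !glueE !in_O.
apply/eqP/(joint_transP q r a) => [e D aD /stableP hD|h].
  apply/eqP; rewrite -subTset; apply/subsetP=> b _.
  rewrite -(mem_imset _ _ hl_inj); have : hl b \in J by rewrite e in_O.
  apply/subsetP/joint_orbit_min; first by rewrite mem_imset.
  apply/stableP=> _ /imsetP[c /hD[c1 c2] ->].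
  by rewrite !glueE /= !(mem_imset _ _ hl_inj).
apply/eqP; rewrite eqEsubset JO; apply/subsetP=> _ /imsetP[b _ ->].
have : b \in [set c | hl c \in J].
  rewrite (h [set c | hl c \in J]) ?inE ?joint_orbit_refl //.
  by apply/stableP=> c; rewrite !inE => /hJ; rewrite !glueE.
by rewrite inE.
Qed.

Definition unglue (p : {perm T}) : {perm A} * {perm B} :=
  odflt (1%g, 1%g) [pick qq : {perm A} * {perm B} | p == glue qq.1 qq.2].

Lemma glueK q k : unglue (glue q k) = (q, k).
Proof.
rewrite /unglue; case: pickP => [[r l] /eqP /glue_injl [-> ->] //|/(_ (q, k))].
by rewrite eqxx.
Qed.

Lemma unglueK (p : {perm T}) : (forall y, y \in O -> p y \in O) -> glue (unglue p).1 (unglue p).2 = p.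
Proof. by case/glue_surj=> q [k ->]; rewrite glueK. Qed.

Section Sum.
Variables (R : comNzRingType) (x y z : R).

(* As in [triple_sum], the first component is the black permutation and the second
   one is the white permutation. *)
Definition weight (U : finType) (ps : {perm U} * {perm U}) : R :=
  x ^+ cyc ps.1 * (y ^+ cyc ps.2 * z ^+ cyc (ps.2 * ps.1)%g).

Lemma weight_glue q r k l :
  weight (glue q k, glue r l) = weight (q, r) * weight (k, l).
Proof. by rewrite /weight /= -glueM !cyc_glue !exprD (mulrACA (y ^+ _)) (mulrACA (x ^+ _)). Qed.

(** Permutations preserving the image of A also preserve its complement, so the pair is glued from a
    transitive pair on A and an arbitrary pair on B. Cycle counts add, so weights multiply. *)
Lemma sum_joint_orbit a :
  \sum_(ps | joint_orbit ps.1 ps.2 (H (inl a)) == O) weight ps =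
  (\sum_(ps : {perm A} * {perm A} | joint_trans ps.1 ps.2) weight ps) *
  \sum_(ps : {perm B} * {perm B}) weight ps.
Proof.
rewrite mulr_suml; under [RHS]eq_bigr => qr _ do rewrite mulr_sumr.
rewrite pair_big_dep /=.
rewrite (reindex_onto
  (fun w : ({perm A} * {perm A}) * ({perm B} * {perm B}) => (glue w.1.1 w.2.1, glue w.1.2 w.2.2))
  (fun ps => (((unglue ps.1).1, (unglue ps.2).1), ((unglue ps.1).2, (unglue ps.2).2)))) /=; last first.
  move=> [p s] /= /eqP e; have /stableP h := joint_orbit_stable p s (H (inl a)).
  by rewrite !unglueK // => c; rewrite -e => /h [].
apply: eq_big => [[[q r] [k l]] | [[q r] [k l]] _] /=; last exact: weight_glue.
by rewrite !glueK /= eqxx !andbT joint_orbit_glue.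
Qed.
End Sum.
End Glue.

Section Exp.
Variables (R : comNzRingType) (x y z : R).
Local Notation weight := (weight x y z).

Definition conn_sum k : R := \sum_(ps : 'S_k * 'S_k | joint_trans ps.1 ps.2) weight ps.

Lemma triple_sumE k : triple_sum k x y z = \sum_(ps : 'S_k * 'S_k) weight ps.
Proof. by rewrite /triple_sum pair_big. Qed.

Section Split.
Variables (T : finType) (O : {set T}).

Definition join_enum (w : 'I_#|O| + 'I_#|~: O|) : T :=
  match w with inl i => enum_val i | inr j => enum_val j end.

Lemma join_enum_bij : bijective join_enum.
Proof.
apply: inj_card_bij; last by rewrite card_sum !card_ord cardsC.
move=> [i|i] [j|j] /= e; try by rewrite (enum_val_inj e).
  by have := enum_valP j; rewrite -e inE enum_valP.
by have := enum_valP i; rewrite e inE enum_valP.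
Qed.

Lemma sum_joint_orbit_on a : a \in O ->
  \sum_(ps : {perm T} * {perm T} | joint_orbit ps.1 ps.2 a == O) weight ps =
  conn_sum #|O| * triple_sum #|~: O| x y z.
Proof.
move=> aO; have [H' HK H'K] := join_enum_bij; rewrite triple_sumE.
have e : a = join_enum (inl (enum_rank_in aO a)) by rewrite /= enum_rankK_in.
have eO : O = [set join_enum (inl i) | i : 'I_#|O|].
  apply/setP=> b; apply/idP/imsetP => [bO|[i _ ->]]; last exact: enum_valP.
  by exists (enum_rank_in bO b); rewrite //= enum_rankK_in.
rewrite e /conn_sum -(sum_joint_orbit HK H'K x y z (enum_rank_in aO a)).
by apply: eq_bigl => ps; rewrite -eO.
Qed.
End Split.

(** The factor n marks a point a, and pairs are sorted by the joint orbit O of a: there are C(n, k)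
    sets O of size k, each with k choices of a. *)
Theorem triple_sum_log n : n%:R * triple_sum n x y z =
  \sum_(k < n.+1) ('C(n, k))%:R * (k%:R * conn_sum k * triple_sum (n - k) x y z).
Proof.
transitivity (\sum_(a : 'I_n) \sum_(O : {set 'I_n} | a \in O) conn_sum #|O| * triple_sum #|~: O| x y z).
  have -> (S : R) : n%:R * S = \sum_(a : 'I_n) S by rewrite sumr_const card_ord mulr_natl.
  apply: eq_bigr => a _.
  rewrite triple_sumE (partition_big (fun ps : 'S_n * 'S_n => joint_orbit ps.1 ps.2 a) (fun O => a \in O)) /=.
    by apply: eq_bigr => O aO; exact: sum_joint_orbit_on.
  by move=> ps _; exact: joint_orbit_refl.
rewrite (exchange_big_dep xpredT) //=.
rewrite (partition_big (fun O : {set 'I_n} => inord #|O| : 'I_n.+1) xpredT) //=.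
apply: eq_bigr => k _.
have cE (O : {set 'I_n}) : (inord #|O| == k) = (#|O| == k).
  by rewrite -val_eqE /= inordK // ltnS -[leqRHS]card_ord max_card.
have -> (S : R) : ('C(n, k))%:R * S = \sum_(O : {set 'I_n} | #|O| == k) S.
  rewrite sumr_const mulr_natl; congr (_ *+ _).
  by rewrite -[X in 'C(X, _)](card_ord n) -card_draws; apply: eq_card => O; rewrite inE.
rewrite (eq_bigl _ _ cE); apply: eq_bigr => O /eqP Ok.
have cO : #|~: O| = (n - k)%N by rewrite cardsCs setCK card_ord Ok.
by rewrite sumr_const cO Ok -mulrA mulr_natl.
Qed.
End Exp.

(** * Counting dessins up to isomorphism *)

Section Relabel.
Variables (E : finType) (m : nat).
Implicit Types (D : dessin E m) (h : {perm E}).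

Lemma relabel1 D : relabel 1%g D = D.
Proof.
case: D => w b f; rewrite /relabel !conjg1; congr Dessin; apply/ffunP=> i.
by rewrite ffunE /= (eq_imset _ (@perm1 E)) imset_id.
Qed.

Lemma relabelM g h D : relabel (g * h)%g D = relabel h (relabel g D).
Proof.
case: D => w b f; rewrite /relabel /= !conjgM; congr Dessin; apply/ffunP=> i.
by rewrite !ffunE /= -imset_comp; apply: eq_imset => x; rewrite permM.
Qed.

Lemma porbitJ (s h : {perm E}) x : porbit (s ^ h) (h x) = h @: porbit s x.
Proof.
apply/setP=> y; apply/porbitP/imsetP => [[i ->]|[z /porbitP[i ->] ->]].
  by exists ((s ^+ i)%g x); rewrite ?mem_porbit // -conjXg permJ.
by exists i; rewrite -conjXg permJ.
Qed.

Lemma porbitsJ (s h : {perm E}) : porbits (s ^ h) = [set h @: A | A : {set E} in porbits s].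
Proof.
apply/setP=> A; apply/imsetP/imsetP => [[x _ ->]|[_ /imsetP[x _ ->] ->]].
  by exists (porbit s (h^-1%g x)); rewrite ?imset_f // -porbitJ permKV.
by exists (h x); rewrite ?porbitJ.
Qed.

Lemma card_porbitsJ (s h : {perm E}) : #|porbits (s ^ h)| = #|porbits s|.
Proof. by rewrite porbitsJ card_imset //; exact: imset_inj perm_inj. Qed.

Lemma joint_transJ (p s h : {perm E}) : joint_trans p s -> joint_trans (p ^ h) (s ^ h).
Proof.
move=> tr; have [x _ _] := imsetP tr; apply/(joint_transP _ _ (h x)) => B hx /stableP hB.
have e : [set y | h y \in B] = [set: E].
  apply: (joint_transP _ _ x tr); rewrite ?inE //; apply/stableP=> y; rewrite !inE => /hB.
  by rewrite !permJ.
apply/setP=> y; rewrite inE -[y](permKV h).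
by have := in_setT (h^-1%g y); rewrite -e inE.
Qed.

Lemma is_dessin_relabel k l mu h D : is_dessin k l mu D -> is_dessin k l mu (relabel h D).
Proof.
case: D => w b f /and5P[/eqP hw /eqP hb tr inj /andP[/eqP hf mu_f]].
rewrite /is_dessin /= !card_porbitsJ hw hb !eqxx -/(joint_trans _ _) joint_transJ //=.
have hi : injective (fun A : {set E} => h @: A) by exact: imset_inj perm_inj.
apply/and3P; split.
- by apply/injectiveP=> i j; rewrite !ffunE => /hi; exact: (injectiveP _ inj).
- rewrite -conjMg porbitsJ -hf -imset_comp; apply/eqP/eq_imset => i /=; by rewrite ffunE.
apply/forallP=> i; rewrite ffunE card_imset; last exact: perm_inj.
exact: (forallP mu_f).
Qed.

(** By orbit-stabilizer, an isomorphism class with automorphism group Aut has |E|! / |Aut|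
    elements. *)
Lemma sum_dessin_aut (S : {set dessin E m}) :
  (forall h D, D \in S -> relabel h D \in S) ->
  \sum_(D in transversal (equivalence_partition (@dessin_iso E m) S) S) (#|dessin_aut D|%:R)^-1
    = #|S|%:R / (#|E|`!)%:R :> rat.
Proof.
move=> hS.
pose to : {action {perm E} &-> dessin E m} :=
  @TotalAction _ _ (fun D h => relabel h D) relabel1 (fun D g h => relabelM g h D).
have isoE D D' : dessin_iso D D' = (D' \in orbit to [set: {perm E}] D).
  apply/existsP/orbitP => [[h /eqP <-]|[h _ <-]]; first by exists h; rewrite ?inE.
  by exists h.
have eqv : {in S & &, equivalence_rel (@dessin_iso E m)}.
  move=> D D' D'' _ _ _; rewrite !isoE; split; first exact: orbit_refl.
  by move=> h; rewrite (orbit_eqP h).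
set P := equivalence_partition _ S; have Ppart : partition P S := equivalence_partitionP eqv.
have trX := transversalP Ppart; set X := transversal P S in trX *.
have autE D : dessin_aut D = ('C_[set: {perm E}][D | to])%g.
  by apply/setP=> h; rewrite !inE /= sub1set inE.
have cardB D : D \in S -> (#|dessin_aut D|%:R)^-1 = #|pblock P D|%:R / (#|E|`!)%:R :> rat.
  move=> DS; have -> : pblock P D = orbit to [set: {perm E}] D.
    apply/setP=> D'; have [D'S|D'S] := boolP (D' \in S).
      by rewrite (pblock_equivalence_partition eqv) // isoE.
    have -> : (D' \in orbit to [set: {perm E}] D) = false.
      by apply/negbTE; apply: contra D'S => /orbitP[h _ <-]; exact: hS.
    apply/negbTE; apply: contra D'S => h; rewrite -(cover_partition Ppart).
    by apply/bigcupP; exists (pblock P D) => //; rewrite pblock_mem // (cover_partition Ppart).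
  have := card_orbit_stab to [set: {perm E}]%G D; rewrite -autE cardsT.
  have -> : #|{perm E}| = #|E|`!.
    rewrite -[in RHS]cardsT -card_perm; apply: eq_card => h.
    by rewrite !inE; apply/esym/subsetP => x; rewrite inE.
  move=> <-.
  have h0 : (#|dessin_aut D|%:R : rat) != 0.
    by rewrite pnatr_eq0 -lt0n; apply/card_gt0P; exists 1%g; rewrite inE relabel1.
  have h1 : (#|orbit to [set: {perm E}] D|%:R : rat) != 0.
    by rewrite pnatr_eq0 -lt0n; apply/card_gt0P; exists D; exact: orbit_refl.
  by rewrite natrM; field; rewrite h0 h1.
transitivity (\sum_(D in X) (#|pblock P D|%:R / (#|E|`!)%:R : rat)).
  by apply: eq_bigr => D DX; rewrite cardB // (subsetP (transversal_sub trX)).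
rewrite -mulr_suml; congr (_ / _); rewrite -natr_sum; congr (_%:R).
rewrite (card_partition Ppart) -(big_imset (fun B : {set dessin E m} => #|B|) (pblock_inj trX)).
by rewrite (pblock_transversal trX).
Qed.
End Relabel.

Lemma num_dessinsE k l m (mu : 'I_m -> nat) n : (\sum_i mu i = n)%N ->
  num_dessins k l mu = #|[set D : dessin 'I_n m | is_dessin k l mu D]|%:R / (n`!)%:R.
Proof.
case: n / ; rewrite /num_dessins sum_dessin_aut ?card_ord // => h D; rewrite !inE.
exact: is_dessin_relabel.
Qed.

(** These m! labelings cancel the factor 1/m! of [genF]. *)
Lemma card_face_labelings (T : finType) (Q : {set T}) m :
  #|[set f : {ffun 'I_m -> T} | injectiveb f && ([set f i | i : 'I_m] == Q)]|
    = ((#|Q| == m) * m`!)%N.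
Proof.
have [Qm|Qm] := eqVneq #|Q| m; last first.
  rewrite mul0n; apply/eqP; rewrite cards_eq0 -subset0; apply/subsetP=> f; rewrite inE.
  by case/andP=> /injectiveP fi /eqP fQ; case/eqP: Qm; rewrite -fQ card_imset // card_ord.
rewrite mul1n -ffactnn; have := @card_inj_ffuns_on 'I_m T (mem Q); rewrite card_ord Qm => <-.
apply: eq_card => f; rewrite !inE andbC; apply/andP/andP => -[h fi]; split=> //.
  by apply/ffun_onP=> i; rewrite -(eqP h) imset_f.
rewrite eqEcard card_imset ?card_ord ?Qm ?leqnn ?andbT; last exact/injectiveP.
by apply/subsetP=> _ /imsetP[i _ ->]; exact: (ffun_onP h).
Qed.

Section GenF.
Variables (A : comAlgType rat) (u v t : A) (d : nat).

Let Dset k l m := [set D : dessin 'I_d m | [&& #|porbits (white D)| == k, #|porbits (black D)| == l,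
  joint_trans (black D) (white D), injectiveb (face D)
  & [set face D i | i : 'I_m] == porbits (white D * black D)%g]].

(** The degrees mu are recovered as the sizes of the faces, which partition the d edges; summing
    over mu just removes that condition. *)
Lemma sum_num_dessins k l m :
  \sum_(mu : {ffun 'I_m -> 'I_d.+1} | [forall i, 0 < mu i]%N && (\sum_i mu i == d)%N)
    num_dessins k l (fun i => mu i : nat) = #|Dset k l m|%:R / (d`!)%:R.
Proof.
pose S (mu : {ffun 'I_m -> 'I_d.+1}) := [set D : dessin 'I_d m | is_dessin k l (fun i => mu i : nat) D].
transitivity (\sum_(mu : {ffun 'I_m -> 'I_d.+1} | [forall i, 0 < mu i]%N && (\sum_i mu i == d)%N)
    (#|S mu|%:R / (d`!)%:R : rat)).
  by apply: eq_bigr => mu /andP[_ /eqP e]; rewrite (num_dessinsE k l e).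
rewrite -mulr_suml; congr (_ / _); rewrite -natr_sum; congr (_%:R).
pose mu_of (D : dessin 'I_d m) := [ffun i : 'I_m => inord #|face D i| : 'I_d.+1].
have muE D i : mu_of D i = #|face D i| :> nat.
  by rewrite ffunE inordK // ltnS -[leqRHS]card_ord max_card.
rewrite -sum1_card (partition_big mu_of (fun mu => [forall i, 0 < mu i]%N && (\sum_i mu i == d)%N)) /=.
  apply: eq_bigr => mu _; rewrite -sum1_card; apply: eq_bigl => D.
  rewrite !inE /is_dessin -/(joint_trans _ _) -!andbA; do 5!congr (_ && _).
  apply/forallP/eqP => [h|<- i]; last by rewrite muE.
  by apply/ffunP=> i; apply: val_inj; rewrite /= muE (eqP (h i)).
move=> D; rewrite inE => /and5P[_ _ _ /injectiveP inj /eqP fE].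
have fo i : face D i \in porbits (white D * black D)%g by rewrite -fE imset_f.
apply/andP; split.
  apply/forallP=> i; rewrite muE; apply/card_gt0P.
  by have /imsetP[x _ ->] := fo i; exists x; rewrite porbit_id.
under eq_bigr => i _ do rewrite muE.
rewrite -[d in _ == d](card_ord d) -(cardsT 'I_d).
have part : partition (porbits (white D * black D)%g) [set: 'I_d].
  have -> : porbits (white D * black D)%g = orbit 'P%act <[white D * black D]>%g @: [set: 'I_d].
    have oE (q : 'S_d) x : orbit 'P%act <[q]>%g x = porbit q x.
      apply/setP=> y; apply/orbitP/porbitP => [[a /cycleP[i ->] <-]|[i ->]]; first by exists i.
      by exists (q ^+ i)%g; rewrite ?mem_cycle.
    by apply/setP=> B; apply/imsetP/imsetP => -[x _ ->]; exists x; rewrite ?inE ?oE.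
  apply: orbit_partition; apply/subsetP=> h _; rewrite !inE /=.
  by apply/subsetP=> x _; rewrite !inE.
rewrite (card_partition part) -fE big_imset //= => i j _ _; exact: inj.
Qed.

Lemma card_Dset k l m : #|Dset k l m| =
  (\sum_(ps : 'S_d * 'S_d | joint_trans ps.1 ps.2)
    ((cyc ps.2 == k) && (cyc ps.1 == l) && (cyc (ps.2 * ps.1)%g == m)) * m`!)%N.
Proof.
rewrite -sum1_card (partition_big (fun D : dessin 'I_d m => (black D, white D)) (fun ps => joint_trans ps.1 ps.2)) /=.
  apply: eq_bigr => -[p s] /= tr; rewrite sum1_card.
  have -> : #|[pred D in Dset k l m | (black D, white D) == (p, s)]| =
    #|[set f : {ffun 'I_m -> {set 'I_d}} | [&& cyc s == k, cyc p == l & injectiveb f && ([set f i | i : 'I_m] == porbits (s * p)%g)]]|.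
    rewrite -(card_imset _ (f := fun f => Dessin s p f)); last by move=> f g [].
    apply: eq_card => D; rewrite !inE; apply/idP/imsetP.
      case/andP=> /and5P[h1 h2 _ h4 h5] /eqP[e1 e2]; exists (face D); last by case: (D) e1 e2 => ? ? ? /= -> ->.
      by rewrite inE -e1 -e2 /cyc h1 h2 h4 h5.
    case=> f; rewrite inE => /and4P[h1 h2 h3 h4] ->; rewrite /= eqxx andbT.
    by rewrite h1 h2 tr h3 h4.
  case: (cyc s == k) => /=; last by rewrite mul0n; apply/eqP; rewrite cards_eq0; apply/eqP/setP=> f; rewrite !inE.
  case: (cyc p == l) => /=; last by rewrite mul0n; apply/eqP; rewrite cards_eq0; apply/eqP/setP=> f; rewrite !inE.
  by rewrite card_face_labelings.
by move=> D; rewrite inE => /and5P[].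
Qed.

Lemma cyc_bounds (s : 'S_d) : (0 < d)%N -> (0 < cyc s < d.+1)%N.
Proof.
move=> d0; apply/andP; split; last by rewrite ltnS (leq_trans (leq_imset_card _ _)) // card_ord.
by apply/card_gt0P; exists (porbit s (Ordinal d0)); exact: imset_f.
Qed.

Theorem genF_conn : genF u v (fun=> t) d = (d`!%:R^-1 : rat) *: conn_sum v u t d.
Proof.
have [d0|d0] := posnP d.
  (* Without edges no pair is transitive, so [conn_sum] is an empty sum too. *)
  rewrite /genF d0 big_geq // /conn_sum big1 ?scaler0 // => ps /imsetP[x _ _].
  by case: x.
rewrite /genF.
transitivity (\sum_(1 <= k < d.+1) \sum_(1 <= l < d.+1) \sum_(1 <= m < d.+1)
   \sum_(ps : 'S_d * 'S_d | joint_trans ps.1 ps.2)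
     (d`!%:R^-1 : rat) *: (((cyc ps.2 == k) && (cyc ps.1 == l) && (cyc (ps.2 * ps.1)%g == m))%:R *
        (u ^+ k * v ^+ l * t ^+ m))).
  apply: eq_bigr => k _; apply: eq_bigr => l _; apply: eq_bigr => m _.
  have pE : \prod_(i < m) t = t ^+ m by rewrite big_const_ord iter_mulr_1.
  rewrite pE -scaler_suml sum_num_dessins card_Dset scalerA.
  rewrite -big_distrl /= natrM -scaler_sumr -mulr_suml -natr_sum -scaler_nat -scalerAl mul1r scalerA.
  congr (_ *: _); have : (m`!%:R : rat) != 0 by rewrite pnatr_eq0 -lt0n fact_gt0.
  by move=> h; field; rewrite h pnatr_eq0 -lt0n fact_gt0.
rewrite /conn_sum scaler_sumr.
under eq_bigr => k _ do under eq_bigr => l _ do rewrite exchange_big.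
under eq_bigr => k _ do rewrite exchange_big.
rewrite exchange_big /=; apply: eq_bigr => ps _.
have pick (F : nat -> A) (s : 'S_d) : \sum_(1 <= k < d.+1) (cyc s == k)%:R * F k = F (cyc s).
  rewrite (bigD1_seq (cyc s)) ?iota_uniq ?mem_index_iota ?cyc_bounds //= eqxx mul1r.
  by rewrite big1 ?addr0 // => k ks; rewrite eq_sym (negPf ks) mul0r.
transitivity ((d`!%:R^-1 : rat) *: \sum_(1 <= k < d.+1) (cyc ps.2 == k)%:R * (\sum_(1 <= l < d.+1) (cyc ps.1 == l)%:R *
   (\sum_(1 <= m < d.+1) (cyc (ps.2 * ps.1)%g == m)%:R * (u ^+ k * v ^+ l * t ^+ m)))).
  rewrite scaler_sumr; apply: eq_bigr => k _; rewrite mulr_sumr scaler_sumr; apply: eq_bigr => l _.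
  rewrite !mulr_sumr scaler_sumr; apply: eq_bigr => m _; congr (_ *: _).
  by rewrite -!mulnb !natrM !mulrA.
by rewrite !pick /weight; congr (_ *: _); rewrite -mulrA mulrCA.
Qed.
End GenF.

(** * The recursion *)

Lemma poly_eq0_inj (p : {poly rat}) (g : nat -> rat) :
  injective g -> (forall n, p.[g n] = 0) -> p = 0.
Proof.
move=> gi h; apply/eqP/contraT => p0.
have := max_poly_roots (rs := [seq g i | i <- iota 0 (size p)]) p0.
rewrite size_map size_iota ltnn; apply; last by rewrite map_inj_uniq ?iota_uniq.
by apply/allP=> _ /mapP[i _ ->]; rewrite /root h.
Qed.

(** A polynomial vanishing at the infinitely many values of g is zero, so each of its coefficients
    vanishes. [mpoly_eq0_grid] uses this for al, then N, then M. *)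
Lemma sum_expr_sep (I : Type) (r : seq I) (c : I -> rat) (e : I -> nat) (g : nat -> rat) k :
  injective g -> (forall n, \sum_(i <- r) c i * g n ^+ e i = 0) -> \sum_(i <- r | e i == k) c i = 0.
Proof.
move=> gi h; have p0 : \sum_(i <- r) c i *: 'X^(e i) = 0 :> {poly rat}.
  apply: (poly_eq0_inj gi) => n; rewrite -[RHS](h n) horner_sum; apply: eq_bigr => i _.
  by rewrite hornerZ hornerXn.
have := congr1 (fun p : {poly rat} => p`_k) p0; rewrite /= coef_sum coef0 => {2}<-.
rewrite big_mkcond; apply: eq_bigr => i _; rewrite coefZ coefXn eq_sym.
by case: eqP; rewrite ?mulr1 ?mulr0.
Qed.

(* The points (t, u, v) = (N + al, N, -M) form a Zariski dense set. *)
Definition grid (N al M : nat) (i : 'I_3) : rat :=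
  if i == inord 0 then (N + al)%:R else if i == inord 1 then N%:R else - M%:R.

Lemma mpoly_eq0_grid (p : {mpoly rat[3]}) : (forall N al M, p.@[grid N al M] = 0) -> p = 0.
Proof.
move=> h; pose i0 : 'I_3 := inord 0; pose i1 : 'I_3 := inord 1; pose i2 : 'I_3 := inord 2.
have i10 : i1 != i0 by rewrite -val_eqE /= !inordK.
have i20 : i2 != i0 by rewrite -val_eqE /= !inordK.
have i21 : i2 != i1 by rewrite -val_eqE /= !inordK.
have ordE (i : 'I_3) : [|| i == i0, i == i1 | i == i2].
  by case: i => [[|[|[|i]]]] //= hi; rewrite -!val_eqE /= !inordK.
have pE (F : 'I_3 -> rat) : \prod_i F i = F i0 * (F i1 * F i2).
  rewrite (bigD1 i0) //= (bigD1 i1) //= (bigD1 i2) /= ?i20 ?i21 // big1 ?mulr1 // => i.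
  by case/andP=> /andP[/negPf a /negPf b] /negPf c; have := ordE i; rewrite a b c.
have h1 N al M : \sum_(m <- msupp p) p@_m * (- M%:R) ^+ m i2 * N%:R ^+ m i1 * (N + al)%:R ^+ m i0 = 0.
  rewrite -[RHS](h N al M) mevalE; apply: eq_bigr => m _.
  rewrite pE /grid eqxx (negPf i10) eqxx (negPf i20) (negPf i21); ring.
have h2 (k N M : nat) : \sum_(m <- msupp p | m i0 == k) p@_m * (- M%:R) ^+ m i2 * N%:R ^+ m i1 = 0.
  apply: (sum_expr_sep (g := fun al => (N + al)%:R)) => [a b /eqP|al]; last exact: h1.
  by rewrite eqr_nat eqn_add2l => /eqP.
have h3 (k l M : nat) : \sum_(m <- [seq m : 'X_{1..3} <- msupp p | m i0 == k] | m i1 == l) p@_m * (- M%:R) ^+ m i2 = 0.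
  apply: (sum_expr_sep (g := fun N => N%:R)) => [a b /eqP|N]; last by rewrite big_filter h2.
  by rewrite eqr_nat => /eqP.
have h4 (k l j : nat) : \sum_(m <- [seq m : 'X_{1..3} <- [seq m : 'X_{1..3} <- msupp p | m i0 == k] | m i1 == l] | m i2 == j) p@_m = 0.
  apply: (sum_expr_sep (g := fun M => - M%:R)) => [a b /eqP|M]; last by rewrite big_filter h3.
  by rewrite eqr_opp eqr_nat => /eqP.
apply/mpolyP=> m; rewrite mcoeff0; have [mp|] := boolP (m \in msupp p); last first.
  by rewrite -mcoeff_eq0 => /eqP.
have := h4 (m i0) (m i1) (m i2); rewrite -big_filter.
set r := [seq _ <- _ | _]; have -> : r = [:: m].
  apply: perm_small_eq => //; apply: uniq_perm; rewrite ?filter_uniq ?msupp_uniq // => m'.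
  rewrite !mem_filter inE; apply/idP/eqP => [/and4P[/eqP e2 /eqP e1 /eqP e0 _]|->]; last by rewrite !eqxx.
  by apply/mnmP=> i; have /or3P[] := ordE i => /eqP ->.
by rewrite big_seq1.
Qed.

Lemma sum_cauchy (R : comNzRingType) n (a b : nat -> R) :
  (forall i j, (n <= i + j)%N -> a i * b j = 0) ->
  (\sum_(i < n) a i) * (\sum_(i < n) b i) = \sum_(g < n) \sum_(0 <= i < g.+1) a i * b (g - i)%N.
Proof.
move=> h; pose A := \poly_(i < n) a i; pose B := \poly_(i < n) b i.
have s1 (c : nat -> R) : \sum_(i < n) c i = (\poly_(i < n) c i).[1].
  rewrite (horner_coef_wide _ (size_poly n c)); apply: eq_bigr => i _.
  by rewrite coef_poly ltn_ord expr1n mulr1.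
have sAB : (size (A * B)%R <= n)%N.
  apply/leq_sizeP=> k nk; rewrite coefM big1 // => i _; rewrite !coef_poly.
  case: ifP => _; rewrite ?mul0r //; case: ifP => _; rewrite ?mulr0 //.
  by apply: h; rewrite subnKC // -ltnS.
rewrite !s1 -hornerM (horner_coef_wide _ sAB); apply: eq_bigr => g _.
rewrite expr1n mulr1 coefM big_mkord; apply: eq_bigr => i _; rewrite !coef_poly.
have ig : (i <= g)%N by rewrite -ltnS.
by rewrite (leq_ltn_trans ig) // (leq_ltn_trans (leq_subr _ _)).
Qed.

(* The coefficients of s df/ds; summed over all genera they satisfy a single recursion. *)
Definition theta_f d : {mpoly rat[3]} := d%:R *: f_coef d.
Definition Z_coef d : {mpoly rat[3]} := (d`!%:R^-1 : rat) *: triple_sum d v u t.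

Lemma Z_coef0 : Z_coef 0 = 1.
Proof.
rewrite /Z_coef fact0 invr1 scale1r /triple_sum.
under eq_bigr => p _ do under eq_bigr => s _ do rewrite !cyc_perm0 !expr0 !mulr1.
by rewrite !sumr_const !card_Sn.
Qed.

Lemma theta_f0 : theta_f 0 = 0. Proof. by rewrite /theta_f scale0r. Qed.

Lemma Z_coef_log d : d%:R * Z_coef d = \sum_(k < d.+1) theta_f k * Z_coef (d - k)%N.
Proof.
have fn0 k : (k`!%:R : rat) != 0 by rewrite pnatr_eq0 -lt0n fact_gt0.
rewrite /Z_coef -scalerAr triple_sum_log scaler_sumr; apply: eq_bigr => k _.
rewrite /theta_f /f_coef genF_conn -!mulrA !mulr_natl -!scaler_nat !scalerA -scalerAl -scalerAr !scalerA.
congr (_ *: _); have kd : (k <= d)%N by rewrite -ltnS.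
have := bin_fact kd => /(congr1 (fun i => i%:R : rat)); rewrite !natrM => e.
have := fn0 d; rewrite -e => h; field; rewrite !fn0 /=.
by apply: contra h => /eqP ->; rewrite mul0r.
Qed.

Section Rec.
Variables (N al M : nat).
Let w := grid N al M.
Let x : rat := - M%:R. Let y : rat := N%:R. Let z : rat := (N + al)%:R.

Lemma eval_t : t.@[w] = z.
Proof. by rewrite mevalXU /w /grid eqxx. Qed.

Lemma eval_u : u.@[w] = y.
Proof. by rewrite mevalXU /w /grid eqxx -val_eqE /= !inordK. Qed.

Lemma eval_v : v.@[w] = x.
Proof. by rewrite mevalXU /w /grid -!val_eqE /= !inordK. Qed.

Lemma eval_Z_coef d : (Z_coef d).@[w] = triple_sum d x y z / (d`!)%:R.
Proof.
rewrite /Z_coef mevalZ mulrC; congr (_ / _); rewrite /triple_sum rmorph_sum; apply: eq_bigr => p _.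
rewrite rmorph_sum; apply: eq_bigr => s _.
by rewrite !rmorphM !rmorphXn /= eval_t eval_u eval_v.
Qed.

Lemma eval_rec d (a := z + y + x) (b := 4%:R * (z * y + z * x + y * x) - a ^+ 2)
   (f := fun d => (theta_f d).@[w]) : (2 <= d)%N ->
  (d + 1)%:R * f d = (2 * d - 1)%:R * a * f (d - 1)%N + (d - 2)%:R * b * f (d - 2)%N
    + ((d - 1) ^ 2 * (d - 2))%:R * f (d - 2)%N
    + \sum_(1 <= j < d - 2) ((4 + 6 * j) * (d - 2 - j))%:R * f j * f (d - 2 - j)%N.
Proof.
(* The truncation must exceed N M for [genZ_bilin], and d for the coefficient of s^d to be
   visible. *)
move=> d2; pose n := (N * M + d).+1; pose Z k := (Z_coef k).@[w].
have hB : bilin (@euler rat) 'X x%:P y%:P z%:P (\poly_(k < n) Z k) = 0.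
  have -> : \poly_(k < n) Z k = genZ n x y z.
    by apply/polyP=> k; rewrite !coef_poly /Z eval_Z_coef.
  rewrite /x /y /z rmorphN !rmorph_nat; apply: genZ_bilin.
  by rewrite /n ltnS leq_addr.
have := @log_rec x y z f Z n _ _ _ d hB; rewrite /f /Z theta_f0 Z_coef0 raddf0 rmorph1.
have -> : x + y + z = a by rewrite /a; ring.
have -> : 4%:R * (x * y + x * z + y * z) = 4%:R * (z * y + z * x + y * x) by ring.
apply=> //; last by rewrite d2 /n /= ltnS leq_addl.
move=> k; have := congr1 (meval w) (Z_coef_log k); rewrite rmorphM rmorph_nat rmorph_sum => ->.
by apply: eq_bigr => j _; rewrite rmorphM.
Qed.
End Rec.

Theorem theta_f_rec d (a := t + u + v) (b := 4%:R * (t * u + t * v + u * v) - a ^+ 2) : (2 <= d)%N ->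
  (d + 1)%:R * theta_f d = (2 * d - 1)%:R * a * theta_f (d - 1) + (d - 2)%:R * b * theta_f (d - 2)
    + ((d - 1) ^ 2 * (d - 2))%:R * theta_f (d - 2)
    + \sum_(1 <= j < d - 2) ((4 + 6 * j) * (d - 2 - j))%:R * theta_f j * theta_f (d - 2 - j).
Proof.
move=> d2; apply/eqP; rewrite -subr_eq0; apply/eqP/mpoly_eq0_grid => N al M.
apply/eqP; rewrite mevalB subr_eq0; apply/eqP.
rewrite !(rmorph_nat, rmorph_sum, rmorphM, rmorphB, rmorphXn, rmorphD) /= !eval_t !eval_u !eval_v.
have e := eval_rec N al M d2; cbv beta in e; rewrite natrD natrM natrX in e.
rewrite {}e; congr (_ + _).
apply: eq_bigr => j _.
by rewrite !rmorphM !rmorph_nat.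
Qed.

Lemma theta_f1 : theta_f 1 = t * u * v.
Proof.
have := Z_coef_log 1; rewrite mul1r big_ord_recl big_ord1 theta_f0 mul0r add0r Z_coef0 mulr1 => <-.
have c1 (s : 'S_1) : cyc s = 1%N.
  by have := cyc_bounds s isT; rewrite !ltnS; case: (cyc s) => [|[|]].
rewrite /Z_coef invr1 scale1r /triple_sum.
under eq_bigr => p _ do under eq_bigr => s _ do rewrite !c1 !expr1.
by rewrite !sumr_const !card_Sn !mulr1n; ring.
Qed.

(** * Separation of the recursion by genus *)

Local Arguments f_ : simpl never.

Lemma f_E (g d : nat) : (2 * g + 1 <= d)%N -> f_ g%:Z d = pihomog mdeg (d + 2 - 2 * g) (theta_f d).
Proof. by move=> h; rewrite /f_ h /theta_f linearZ. Qed.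

Lemma f_small (g d : nat) : (d < 2 * g + 1)%N -> f_ g%:Z d = 0.
Proof. by rewrite /f_ ltnNge => /negPf ->. Qed.

Lemma f_homog (g d : nat) : f_ g%:Z d \is (d + 2 - 2 * g).-homog.
Proof.
have [h|h] := leqP (2 * g + 1) d; first by rewrite f_E //; exact: pihomogP.
by rewrite f_small //; exact: dhomog0.
Qed.

Lemma dhomog_natM n k (p : {mpoly rat[n]}) c : p \is k.-homog -> c%:R * p \is k.-homog.
Proof. by move=> h; rewrite mulr_natl rpredMn. Qed.

Lemma dhomog_Xi n (i : 'I_n) : ('X_i : {mpoly rat[n]}) \is 1.-homog.
Proof. by rewrite dhomogX /= mdeg1. Qed.

Definition rhs (g d : nat) : {mpoly rat[3]} :=
  let a := t + u + v in
  let b := 4%:R * (t * u + t * v + u * v) - a ^+ 2 in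
  (2 * d - 1)%:R * a * f_ g%:Z (d - 1)
          + (d - 2)%:R * b * f_ g%:Z (d - 2)
          + ((d - 1) ^ 2 * (d - 2))%:R * f_ (g%:Z - 1) (d - 2)
          + \sum_(0 <= i < g.+1) \sum_(1 <= j < d - 2)
              ((4 + 6 * j) * (d - 2 - j))%:R
                * f_ i%:Z j * f_ (g - i)%:Z (d - 2 - j).

Lemma f_pred g d : f_ (g.+1%:Z - 1) d = f_ g%:Z d.
Proof. by have -> : g.+1%:Z - 1 = g%:Z by lia. Qed.

Lemma f_neg1 d : f_ (0%:Z - 1) d = 0. Proof. by []. Qed.

Lemma rhs_small g d : (2 <= d)%N -> (d < 2 * g + 1)%N -> rhs g d = 0.
Proof.
move=> d2 dg; rewrite /rhs !f_small ?mulr0 ?add0r; try lia.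
case: g dg => [|g] dg; first by lia.
rewrite f_pred f_small ?mulr0 ?add0r; last by lia.
rewrite big_nat big1 // => i /andP[_ ig]; rewrite big_nat big1 // => j /andP[j1 jd].
have [h|h] := leqP (2 * i + 1) j; last by rewrite (f_small h) mulr0 mul0r.
by rewrite [f_ (g.+1 - i)%:Z _]f_small ?mulr0 //; lia.
Qed.

Lemma rhs_homog g d : (2 <= d)%N -> (2 * g + 1 <= d)%N -> rhs g d \is (d + 2 - 2 * g).-homog.
Proof.
move=> d2 dg.
have ht : t \is 1.-homog by exact: dhomog_Xi.
have hu : u \is 1.-homog by exact: dhomog_Xi.
have hv : v \is 1.-homog by exact: dhomog_Xi.
have ha : t + u + v \is 1.-homog by rewrite !rpredD.
have hb : 4%:R * (t * u + t * v + u * v) - (t + u + v) ^+ 2 \is 2.-homog.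
  apply: rpredB; last by rewrite expr2; exact: (dhomogM ha ha).
  by apply: dhomog_natM; rewrite !rpredD // -[2%N]/(1 + 1)%N; apply: dhomogM.
rewrite /rhs; apply: rpredD; [apply: rpredD; [apply: rpredD|]|].
- have [h|h] := leqP (2 * g + 1) (d - 1); last by rewrite (f_small h) mulr0 dhomog0.
  rewrite -mulrA; apply: dhomog_natM; rewrite (_ : d + 2 - 2 * g = 1 + (d - 1 + 2 - 2 * g))%N; last by lia.
  by apply: dhomogM => //; exact: f_homog.
- have [h|h] := leqP (2 * g + 1) (d - 2); last by rewrite (f_small h) mulr0 dhomog0.
  rewrite -mulrA; apply: dhomog_natM; rewrite (_ : d + 2 - 2 * g = 2 + (d - 2 + 2 - 2 * g))%N; last by lia.
  by apply: dhomogM => //; exact: f_homog.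
- case: g dg => [|g] dg; first by rewrite f_neg1 mulr0 dhomog0.
  rewrite f_pred; apply: dhomog_natM.
  by rewrite (_ : d + 2 - 2 * g.+1 = d - 2 + 2 - 2 * g)%N; [exact: f_homog | lia].
rewrite big_nat; apply: rpred_sum => i /andP[_ ig]; rewrite big_nat; apply: rpred_sum => j /andP[j1 jd].
have [h|h] := leqP (2 * i + 1) j; last by rewrite (f_small h) mulr0 mul0r dhomog0.
have [h'|h'] := leqP (2 * (g - i) + 1) (d - 2 - j); last by rewrite (f_small h') mulr0 dhomog0.
rewrite -mulrA; apply: dhomog_natM.
rewrite (_ : d + 2 - 2 * g = (j + 2 - 2 * i) + (d - 2 - j + 2 - 2 * (g - i)))%N; last by lia.
by apply: dhomogM; exact: f_homog.
Qed.

(* Only the genera with 2g + 1 <= d occur.  This follows from the recursion itself, with no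
   appeal to the Riemann-Hurwitz formula. *)
Definition decomposed d := forall n, (d <= n)%N -> theta_f d = \sum_(g < n) f_ (g : nat)%:Z d.

(** The range in [decomposed] is any n at least d, so all genus sums can share the bound d and the
    convolution becomes a Cauchy product over genera. *)
Lemma sum_rhs d : (2 <= d)%N -> (forall e, (e < d)%N -> decomposed e) ->
  (d + 1)%:R * theta_f d = \sum_(g < d) rhs g d.
Proof.
move=> d2 dec; rewrite (theta_f_rec d2) /rhs !big_split /=; congr (_ + _ + _ + _).
- by rewrite -mulr_sumr -dec //; lia.
- by rewrite -mulr_sumr -dec //; lia.
- rewrite -mulr_sumr; congr (_ * _).
  case: d d2 dec => // d d2 dec; rewrite big_ord_recl f_neg1 add0r.
  under eq_bigr => g _ do rewrite lift0 f_pred.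
  by rewrite -dec //; lia.
under [RHS]eq_bigr => g _ do rewrite exchange_big /=.
rewrite exchange_big /= big_nat [RHS]big_nat; apply: eq_bigr => j /andP[j1 jd].
rewrite -mulrA (dec j _ d) ?(dec (d - 2 - j)%N _ d); try lia.
rewrite (sum_cauchy (a := fun g => f_ g%:Z j) (b := fun g => f_ g%:Z (d - 2 - j))).
  rewrite mulr_sumr; apply: eq_bigr => g _; rewrite mulr_sumr; apply: eq_bigr => i _.
  by rewrite mulrA.
move=> i i' hi; have [h|h] := leqP (2 * i + 1) j; last by rewrite (f_small h) mul0r.
by rewrite [f_ i'%:Z _]f_small ?mulr0 //; lia.
Qed.

Lemma decomposedI d : theta_f d = \sum_(g < d) f_ (g : nat)%:Z d -> decomposed d.
Proof.
move=> h n dn; rewrite h (big_ord_widen_cond n xpredT (fun g => f_ g%:Z d) dn) big_mkcond /=.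
by apply: eq_bigr => g _; case: ltnP => // dg; rewrite f_small //; lia.
Qed.

(** Project [sum_rhs] onto degree d + 2 - 2g. For nonzero [rhs g' d] one has 2g' + 1 <= d, where
    distinct genera give distinct degrees, so only [rhs g d] survives. *)
Lemma f_rhs d : (2 <= d)%N -> (forall e, (e < d)%N -> decomposed e) ->
  forall g, (d + 1)%:R * f_ (g : nat)%:Z d = rhs g d.
Proof.
move=> d2 dec g; have [h|h] := leqP (2 * g + 1) d; last by rewrite f_small // mulr0 rhs_small.
have := congr1 (pihomog mdeg (d + 2 - 2 * g)) (sum_rhs d2 dec).
rewrite !mulr_natl raddfMn /= -(f_E h) => ->; rewrite linear_sum /=.
have gd : (g < d)%N by lia.
rewrite (bigD1 (Ordinal gd)) //= pihomog_dE ?rhs_homog // big1 ?addr0 // => g' g'g.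
have [h'|h'] := leqP (2 * g' + 1) d; last by rewrite rhs_small // raddf0.
apply: (pihomog_ne0 (d := (d + 2 - 2 * g')%N)); last exact: rhs_homog.
by apply: contra g'g => /eqP e; rewrite -val_eqE /=; apply/eqP; lia.
Qed.

(** For d at least 2, [sum_rhs] and [f_rhs] rest only on smaller degrees; dividing by d + 1 closes
    the induction. *)
Lemma decomposed_all d : decomposed d.
Proof.
elim/ltn_ind: d => -[|[|d]] IH.
- by apply: decomposedI; rewrite theta_f0 big_ord0.
- apply: decomposedI; rewrite big_ord1 f_E // pihomog_dE // theta_f1.
  exact: (dhomogM (dhomogM (dhomog_Xi (inord 0)) (dhomog_Xi (inord 1))) (dhomog_Xi (inord 2))).
apply: decomposedI; have n0 : ((d.+2 + 1)%:R : rat) != 0 by rewrite pnatr_eq0 addn1.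
apply: (scalerI n0); rewrite !scaler_nat -[LHS]mulr_natl -[RHS]mulr_natl (sum_rhs _ IH) // mulr_sumr.
by apply: eq_bigr => g _; rewrite f_rhs.
Qed.

Theorem mainTheorem9 :
  let a := t + u + v in
  let b := 4%:R * (t * u + t * v + u * v) - a ^+ 2 in
  [/\ (forall d : nat,
        f_coef d = \sum_(g < d | (2 * g + 1 <= d)%N)
                     (d%:R)^-1 *: f_ (g : nat)%:Z d),
      f_ 0 1 = t * u * v
    & forall g d : nat, (2 <= d)%N ->
        (d + 1)%:R * f_ g%:Z d =
            (2 * d - 1)%:R * a * f_ g%:Z (d - 1)
          + (d - 2)%:R * b * f_ g%:Z (d - 2)
          + ((d - 1) ^ 2 * (d - 2))%:R * f_ (g%:Z - 1) (d - 2)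
          + \sum_(0 <= i < g.+1) \sum_(1 <= j < d - 2)
              ((4 + 6 * j) * (d - 2 - j))%:R
                * f_ i%:Z j * f_ (g - i)%:Z (d - 2 - j)].
Proof.
move=> a b; split=> [d||g d d2].
- case: d => [|d].
    by rewrite big_ord0 /f_coef /genF big_geq.
  have n0 : (d.+1%:R : rat) != 0 by rewrite pnatr_eq0.
  apply: (scalerI n0); rewrite -/(theta_f d.+1) (decomposed_all (leqnn _)) scaler_sumr [RHS]big_mkcond.
  apply: eq_bigr => g _; case: leqP => h; first by rewrite scalerA mulfV // scale1r.
  by rewrite f_small.
- have := @decomposed_all 1 1 isT; rewrite big_ord1 theta_f1 => ->; by [].
by apply: f_rhs => // e _; exact: decomposed_all.
Qed.
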